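(* For every $\alpha$ with $1 < \alpha < 2$ and every balance parameter $\omega > 0$ there is a randomized algorithm which, given a positive integer $k$, a set $X$ of $n$ points in $\mathbb{R}^d$ and an outlier parameter $z \in \{1,\dots,n\}$, finds \emph{exactly} a clustering of least $k$-means cost among all clusterings with $z$ outliers that satisfy $\alpha$-center proximity with outliers and are balanced, i.e. each of the $k$ clusters has size at least $\omega n/k$. The algorithm succeeds with constant probability and runs in time $O\big(2^{\mathrm{poly}(k/(\omega(\alpha-1)))}\, n d\big)$.
   Context: For a point $x$ and centers $\mu_1,\dots,\mu_k \in \mathbb{R}^d$, the distance of $x$ to the centers is $\min_i \|x - \mu_i\|$ (Euclidean norm). Given centers $\mu_1,\dots,\mu_k$, let $Z \subseteq X$ be the $z$ points of $X$ farthest from the centers (in this distance), and let $C_1,\dots,C_k$ be the clustering of $X \setminus Z$ in which $C_j$ consists of the points of $X\setminus Z$ whose nearest center is $\mu_j$. This clustering of $X\setminus Z$ with outliers $Z$ satisfies $\alpha$-center proximity with outliers if for all $i \neq j$ and $x \in C_i$ we have $\|x - \mu_j\| > \alpha\|x-\mu_i\|$, and for all $i,j \in [k]$, $x \in C_i$, $y \in Z$ we have $\|y-\mu_j\| > \alpha \|x - \mu_i\|$. For $k$-means the centers are the means of the clusters, and the $k$-means cost is $\sum_{i=1}^k \sum_{x \in C_i}\|x-\mu_i\|^2$ (outliers contribute nothing). *)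

(* Defs.v *)
(* MathComp / MathComp-Analysis *)
From mathcomp Require Import all_boot all_order all_algebra.
From mathcomp Require Import boolp reals ereal exp.

Set Implicit Arguments.
Unset Strict Implicit.
Unset Printing Implicit Defensive.

Import Order.TTheory GRing.Theory Num.Theory.
Local Open Scope ring_scope.

(* The norm that the library puts on 'rV[R]_d is the sup norm. *)
Definition l2norm (R : realType) (d : nat) (x : 'rV[R]_d) : R :=
  Num.sqrt (\sum_(j < d) x ord0 j ^+ 2).

(* The n points are X 0, ..., X (n-1). A labelling f encodes the clusters
   C_j = {X i | f i = Some j} and the outliers Z = {X i | f i = None}. *)
Section Clustering.
Variables (R : realType) (k n d : nat) (X : 'I_n -> 'rV[R]_d).

Definition cluster (f : 'I_n -> option 'I_k) (j : 'I_k) : {set 'I_n} :=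
  [set i | f i == Some j].

Definition outliers (f : 'I_n -> option 'I_k) : {set 'I_n} :=
  [set i | f i == None].

(* Extended-real valued, so that the minimum needs no default centre. *)
Definition center_dist (mu : 'I_k -> 'rV[R]_d) (x : 'rV[R]_d) : \bar R :=
  \big[Order.min/+oo%E]_(j < k) (l2norm (x - mu j))%:E.

(* With tied distances several labellings can be induced by the same mu. *)
Definition induced_clustering (z : nat) (mu : 'I_k -> 'rV[R]_d)
    (f : 'I_n -> option 'I_k) : Prop :=
  [/\ #|outliers f| = z,
      forall x y : 'I_n, x \notin outliers f -> y \in outliers f ->
        (center_dist mu (X x) <= center_dist mu (X y))%E
    & forall (j : 'I_k) (x : 'I_n), x \in cluster f j ->
        (l2norm (X x - mu j))%:E = center_dist mu (X x)].

Definition center_proximity (alpha : R) (mu : 'I_k -> 'rV[R]_d)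
    (f : 'I_n -> option 'I_k) : Prop :=
  (forall (i j : 'I_k) (x : 'I_n), i != j -> x \in cluster f i ->
     l2norm (X x - mu j) > alpha * l2norm (X x - mu i)) /\
  (forall (i j : 'I_k) (x y : 'I_n), x \in cluster f i -> y \in outliers f ->
     l2norm (X y - mu j) > alpha * l2norm (X x - mu i)).

Definition cluster_mean (f : 'I_n -> option 'I_k) (j : 'I_k) : 'rV[R]_d :=
  #|cluster f j|%:R^-1 *: \sum_(x in cluster f j) X x.

Definition kmeans_cost (f : 'I_n -> option 'I_k) : R :=
  \sum_(j < k) \sum_(x in cluster f j) l2norm (X x - cluster_mean f j) ^+ 2.

Definition balanced (omega : R) (f : 'I_n -> option 'I_k) : Prop :=
  forall j : 'I_k, omega * n%:R / k%:R <= #|cluster f j|%:R.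

Definition admissible (alpha omega : R) (z : nat)
    (f : 'I_n -> option 'I_k) : Prop :=
  [/\ induced_clustering z (cluster_mean f) f,
      center_proximity alpha (cluster_mean f) f
    & balanced omega f].

Definition optimal (alpha omega : R) (z : nat)
    (f : 'I_n -> option 'I_k) : Prop :=
  admissible alpha omega z f /\
  forall g : 'I_n -> option 'I_k, admissible alpha omega z g ->
    kmeans_cost f <= kmeans_cost g.

End Clustering.

(* A randomized real RAM with unit cost instructions. Memory consists of
   integer registers, real registers, and numbered arrays of integers and of
   reals (a program mentions finitely many of them). Integers only have
   addition, truncated subtraction and comparison; reals have the field
   operations and comparison. There is no conversion from reals to integers,
   and programs contain no real literals, so that no information can be
   hidden in a constant. *)
Inductive real_op := RAdd | RSub | RMul | RDiv.

Inductive test :=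
| ILt of nat & nat
| RLt of nat & nat.

Inductive prog :=
| ISet of nat & nat
| IAdd of nat & nat & nat
| ISub of nat & nat & nat
| ILoad of nat & nat & nat
| IStore of nat & nat & nat
| ROfI of nat & nat
| ROp of real_op & nat & nat & nat
| RLoad of nat & nat & nat
| RStore of nat & nat & nat
| Draw of nat & nat
| Seq of prog & prog
| Ite of test & prog & prog
| While of test & prog.

Record state (R : Type) := State {
  ireg : nat -> nat;
  rreg : nat -> R;
  iarr : nat -> nat -> nat;
  rarr : nat -> nat -> R
}.

Section Semantics.
Variable R : realType.
Implicit Types s : state R.

Definition set_ireg s (x v : nat) : state R :=
  State [eta ireg s with x |-> v] (rreg s) (iarr s) (rarr s).

Definition set_rreg s (x : nat) (v : R) : state R :=
  State (ireg s) [eta rreg s with x |-> v] (iarr s) (rarr s).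

Definition set_iarr s (a i v : nat) : state R :=
  State (ireg s) (rreg s)
        (fun b => if b == a then [eta iarr s a with i |-> v] : nat -> nat
                  else iarr s b)
        (rarr s).

Definition set_rarr s (a i : nat) (v : R) : state R :=
  State (ireg s) (rreg s) (iarr s)
        (fun b => if b == a then [eta rarr s a with i |-> v] : nat -> R
                  else rarr s b).

(* Division by zero returns zero, as in the library. *)
Definition eval_op (o : real_op) (u v : R) : R :=
  match o with
  | RAdd => u + v
  | RSub => u - v
  | RMul => u * v
  | RDiv => u / v
  end.

Definition eval_test (b : test) s : bool :=
  match b with
  | ILt x y => (ireg s x < ireg s y)%N
  | RLt x y => rreg s x < rreg s y
  end.

(* halts_with E t K s is the probability that the machine, started in state s
   with the list K of programs still to be executed in order, halts after at
   most t steps in a state satisfying E. Every transition, including those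
   that only handle control flow, counts as one step. Draw x y puts a uniformly
   random element of {0, ..., ireg y - 1} into x, independently of the past;
   drawing from the empty range aborts the run, which then never halts. *)
Fixpoint halts_with (E : state R -> Prop) (t : nat) (K : seq prog) s : R :=
  match K with
  | [::] => `[< E s >]%:R
  | c :: K =>
    match t with
    | 0%N => 0
    | t.+1 =>
      match c with
      | ISet x m => halts_with E t K (set_ireg s x m)
      | IAdd x y z => halts_with E t K (set_ireg s x (ireg s y + ireg s z)%N)
      | ISub x y z => halts_with E t K (set_ireg s x (ireg s y - ireg s z)%N)
      | ILoad x a i => halts_with E t K (set_ireg s x (iarr s a (ireg s i)))
      | IStore a i y => halts_with E t K (set_iarr s a (ireg s i) (ireg s y))
      | ROfI x y => halts_with E t K (set_rreg s x (ireg s y)%:R)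
      | ROp o x y z =>
          halts_with E t K (set_rreg s x (eval_op o (rreg s y) (rreg s z)))
      | RLoad x a i => halts_with E t K (set_rreg s x (rarr s a (ireg s i)))
      | RStore a i y => halts_with E t K (set_rarr s a (ireg s i) (rreg s y))
      | Draw x y =>
          (\sum_(m < ireg s y) halts_with E t K (set_ireg s x m))
            / (ireg s y)%:R
      | Seq c1 c2 => halts_with E t [:: c1, c2 & K] s
      | Ite b c1 c2 => halts_with E t ((if eval_test b s then c1 else c2) :: K) s
      | While b c1 =>
          halts_with E t (if eval_test b s then [:: c1, c & K] else K) s
      end
    end
  end.

(* Initially the integer registers 0, 1, 2, 3 hold k, n, d, z, the real
   registers 0 and 1 hold alpha and omega, cell i * d + j of the real array 0
   holds coordinate j of point i, and everything else is 0. *)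
Definition input (alpha omega : R) (k n d z : nat) (X : 'I_n -> 'rV[R]_d) :
    state R :=
  State (nth 0%N [:: k; n; d; z])
        (nth 0 [:: alpha; omega])
        (fun _ _ => 0%N)
        (fun a c => if a == 0%N then
                      \sum_(i < n) \sum_(j < d | (i * d + j)%N == c) X i ord0 j
                    else 0).

(* Cell i of the integer array 0 holds the cluster number of point i; a number
   that is not smaller than k marks an outlier. *)
Definition output (k n : nat) s : 'I_n -> option 'I_k :=
  fun i => insub (iarr s 0 i).

Definition success_probability (A : prog) (t : nat) (E : state R -> Prop) s : R :=
  halts_with E t [:: A] s.

(* Whatever the random draws: they are finitely many within t steps and each
   outcome has positive probability. *)
Definition runs_in_time (A : prog) (t : nat) s : Prop :=
  success_probability A t (fun=> True) s = 1.

End Semantics.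

Arguments output {R} k n s.

(* Main.v *)
(* Draw m = O((alpha - 1)^-4) uniform samples for each of the k clusters. With
   probability at least (omega / k)^(k m) / 2^k all samples of every cluster j lie
   in C_j and their mean is within e_j of the true center. Center proximity
   bounds the radius of C_j by |mu_i - mu_j| / (alpha - 1) and leaves a gap of
   (alpha - 1) / (alpha + 1) |mu_i - mu_j| between the distances of a point to its
   own and to another center, so these approximate centers already induce the
   optimal clustering exactly: the outliers are the z points farthest from them.
   The distance threshold is found by quickselect whose total work is cut off at
   8n, which fails with probability at most 1/2. Each candidate is checked for
   admissibility against its own means and the cheapest one is kept, so that
   2^poly repetitions suffice for success probability 1/2.
   Probabilities are only ever bounded from below; termination in time t is the
   lower bound 1 for the sure event. *)
Require Import Defs.
From mathcomp Require Import all_boot all_order all_algebra.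
From mathcomp Require Import boolp reals ereal exp.
From mathcomp Require Import zify ring lra.

Import Order.TTheory GRing.Theory Num.Theory.
Import Defs.
Local Open Scope ring_scope.

Set Implicit Arguments.
Unset Strict Implicit.
Unset Printing Implicit Defensive.

(** * Halting probabilities of the machine *)

Section Machine.
Variable R : realType.
Implicit Types (s : state R) (E : state R -> Prop) (K : seq prog).

(** Termination and success are two instances of one bound. Each randomized piece is specified
    through its continuation: if all possible end states satisfy
    [a + b * g s' <= halts_with E tt K s'], then the start state satisfies such a bound with [g]
    replaced by a lower bound on its expectation. With [a = 1] and [b = 0] this says that every run
    halts in time; with [a = 0] and [b = 1] it bounds the success probability. Facts about an
    optimal clustering are therefore assumed only under [b != 0]. As [a] and [b] are arbitrary,
    these bounds compose along a program without conditional probabilities. The radii e_j live in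
    the analysis only: the program knows neither them nor which samples are good, and relies on its
    final check. Its literals depend on [alpha] and [omega] alone, so row offsets and the number of
    repetitions must be produced by integer additions. All comparisons are between squared
    distances, since the machine has no square root. *)

Lemma halts_ge0 E t K s : 0 <= halts_with E t K s.
Proof.
elim: t K s => [|t IH] [|c K] s //=; try by rewrite ler0n.
case: c => // x y; rewrite divr_ge0 ?ler0n ?sumr_ge0 //.
Qed.

Lemma halts_le1 E t K s : halts_with E t K s <= 1.
Proof.
elim: t K s => [|t IH] [|c K] s //=; try by rewrite lern1 leq_b1.
case: c => // x y.
have [->|y0] := posnP (ireg s y); first by rewrite big_ord0 mul0r.
rewrite ler_pdivrMr ?ltr0n // mul1r.
by apply: le_trans (ler_sum _ (fun m _ => IH _ _)) _; rewrite sumr_const card_ord.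
Qed.

Definition step (p : prog) s : state R :=
  match p with
  | ISet x m => set_ireg s x m
  | IAdd x y z => set_ireg s x (ireg s y + ireg s z)%N
  | ISub x y z => set_ireg s x (ireg s y - ireg s z)%N
  | ILoad x a i => set_ireg s x (iarr s a (ireg s i))
  | IStore a i y => set_iarr s a (ireg s i) (ireg s y)
  | ROfI x y => set_rreg s x (ireg s y)%:R
  | ROp o x y z => set_rreg s x (eval_op o (rreg s y) (rreg s z))
  | RLoad x a i => set_rreg s x (rarr s a (ireg s i))
  | RStore a i y => set_rarr s a (ireg s i) (rreg s y)
  | _ => s
  end.

Definition is_prim (p : prog) : bool :=
  match p with Draw _ _ | Seq _ _ | Ite _ _ _ | While _ _ => false | _ => true end.

Lemma halts_prim E t p K s : is_prim p ->
  halts_with E t.+1 (p :: K) s = halts_with E t K (step p s).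
Proof. by case: p. Qed.

Lemma halts_draw E t x y K s :
  halts_with E t.+1 (Draw x y :: K) s =
  (\sum_(m < ireg s y) halts_with E t K (set_ireg s x m)) / (ireg s y)%:R.
Proof. by []. Qed.

Lemma halts_seq E t c1 c2 K s :
  halts_with E t.+1 (Seq c1 c2 :: K) s = halts_with E t [:: c1, c2 & K] s.
Proof. by []. Qed.

Lemma halts_ite E t b c1 c2 K s :
  halts_with E t.+1 (Ite b c1 c2 :: K) s =
  halts_with E t ((if eval_test b s then c1 else c2) :: K) s.
Proof. by []. Qed.

Lemma halts_while E t b c K s :
  halts_with E t.+1 (While b c :: K) s =
  halts_with E t (if eval_test b s then [:: c, While b c & K] else K) s.
Proof. by []. Qed.

Lemma haltsS E t K s : halts_with E t K s <= halts_with E t.+1 K s.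
Proof.
elim: t K s => [|t IH] [|c K] s //; first exact: halts_ge0.
have [cp|] := boolP (is_prim c); first by rewrite !halts_prim.
case: c => // [x y|c1 c2|b c1 c2|b c] _.
- rewrite 2!halts_draw; apply: ler_wpM2r; first by rewrite invr_ge0 ler0n.
  by apply: ler_sum => m _; apply: IH.
- by rewrite 2!halts_seq.
- by rewrite 2!halts_ite.
- by rewrite 2!halts_while.
Qed.

(** Allows every exact step count below to be padded to a convenient upper bound. *)
Lemma halts_mono E t t' K s :
  (t <= t')%N -> halts_with E t K s <= halts_with E t' K s.
Proof.
move=> /subnK <-; elim: (t' - t)%N => [|u IH] //.
by apply: le_trans IH _; rewrite addSn haltsS.
Qed.

(** * Deterministic programs with counted loops *)

Inductive cmd :=
| Prim of prog
| CSeq of cmd & cmd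
| CIte of test & cmd & cmd
| CFor of nat & nat & cmd.

(* In all programs register 4 holds the constant 1 and register 29 stays 0. *)
Definition reg1 := 4%N.

Fixpoint compile (c : cmd) : prog :=
  match c with
  | Prim p => p
  | CSeq c1 c2 => Seq (compile c1) (compile c2)
  | CIte b c1 c2 => Ite b (compile c1) (compile c2)
  | CFor i b c =>
      Seq (ISet i 0) (While (ILt i b) (Seq (compile c) (IAdd i i reg1)))
  end.

(** A total function because commands contain neither [Draw] nor [While]. The bound of a loop is
    read once, on entry, whereas the compiled loop reads it before every round; [wf] makes the two
    agree. *)
Fixpoint run (c : cmd) s : state R :=
  match c with
  | Prim p => step p s
  | CSeq c1 c2 => run c2 (run c1 s)
  | CIte b c1 c2 => if eval_test b s then run c1 s else run c2 s
  | CFor i b c => iteri (ireg s b)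
      (fun p s' => set_ireg (run c s') i p.+1) (set_ireg s i 0)
  end.

(** Each round of a loop costs three steps besides its body (test, [Seq], increment); entering and
    leaving cost three more. A branch is charged for both sides, which keeps the bound a
    polynomial. *)
Fixpoint btime (rho : nat -> nat) (c : cmd) : nat :=
  match c with
  | Prim _ => 1
  | CSeq c1 c2 => (btime rho c1 + btime rho c2).+1
  | CIte _ c1 c2 => (btime rho c1 + btime rho c2).+1
  | CFor _ b c => rho b * (btime rho c + 3) + 3
  end.

Definition pmods (p : prog) : seq nat * seq nat * seq nat * seq nat :=
  match p with
  | ISet x _ | IAdd x _ _ | ISub x _ _ | ILoad x _ _ => ([:: x], [::], [::], [::])
  | ROfI x _ | ROp _ x _ _ | RLoad x _ _ => ([::], [:: x], [::], [::])
  | IStore a _ _ => ([::], [::], [:: a], [::])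
  | RStore a _ _ => ([::], [::], [::], [:: a])
  | _ => ([::], [::], [::], [::])
  end.

Fixpoint imods c : seq nat :=
  match c with
  | Prim p => (pmods p).1.1.1
  | CSeq c1 c2 | CIte _ c1 c2 => imods c1 ++ imods c2
  | CFor i _ c => i :: imods c
  end.

Fixpoint rmods c : seq nat :=
  match c with
  | Prim p => (pmods p).1.1.2
  | CSeq c1 c2 | CIte _ c1 c2 => rmods c1 ++ rmods c2
  | CFor _ _ c => rmods c
  end.

Fixpoint iamods c : seq nat :=
  match c with
  | Prim p => (pmods p).1.2
  | CSeq c1 c2 | CIte _ c1 c2 => iamods c1 ++ iamods c2
  | CFor _ _ c => iamods c
  end.

Fixpoint ramods c : seq nat :=
  match c with
  | Prim p => (pmods p).2
  | CSeq c1 c2 | CIte _ c1 c2 => ramods c1 ++ ramods c2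
  | CFor _ _ c => ramods c
  end.

(* The registers in L, among them the loop bounds, are never written. *)
Fixpoint wf (L : seq nat) c : bool :=
  match c with
  | Prim p => is_prim p && all [pred x | x \notin L] (pmods p).1.1.1
  | CSeq c1 c2 | CIte _ c1 c2 => wf L c1 && wf L c2
  | CFor i b c => [&& i \notin L, b \in L, i \notin imods c & wf L c]
  end.

(** A frame condition read off from the syntax: whether a given register or array is covered is
    decided by computation. *)
Definition same (c : cmd) s s' : Prop :=
  [/\ forall x, x \notin imods c -> ireg s' x = ireg s x,
      forall x, x \notin rmods c -> rreg s' x = rreg s x,
      forall a, a \notin iamods c -> iarr s' a = iarr s a
    & forall a, a \notin ramods c -> rarr s' a = rarr s a].

Lemma sameI c s s' x : same c s s' -> x \notin imods c -> ireg s' x = ireg s x.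
Proof. by case=> + _ _ _; apply. Qed.
Lemma sameR c s s' x : same c s s' -> x \notin rmods c -> rreg s' x = rreg s x.
Proof. by case=> _ + _ _; apply. Qed.
Lemma sameIA c s s' a : same c s s' -> a \notin iamods c -> iarr s' a = iarr s a.
Proof. by case=> _ _ + _; apply. Qed.
Lemma sameRA c s s' a : same c s s' -> a \notin ramods c -> rarr s' a = rarr s a.
Proof. by case=> _ _ _; apply. Qed.

Lemma set_iregE s x v y : ireg (set_ireg s x v) y = if y == x then v else ireg s y.
Proof. by []. Qed.

Lemma iteri_same i b c s N :
  (forall s, same c s (run c s)) ->
  same (CFor i b c) s (iteri N
      (fun p s' => set_ireg (run c s') i p.+1) (set_ireg s i 0)).
Proof.
move=> IH; elim: N => [|N [A1 A2 A3 A4]].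
  by split=> //= x; rewrite in_cons negb_or => /andP[/negbTE-> _].
have [B1 B2 B3 B4] := IH (iteri N
      (fun p s' => set_ireg (run c s') i p.+1) (set_ireg s i 0)).
split=> x; rewrite [iteri _.+1 _ _]/=.
- move=> xm; have := xm; rewrite in_cons negb_or => /andP[/negbTE xi xc].
  by rewrite set_iregE xi B1 // A1.
- by move=> xm; rewrite -A2 // -B2.
- by move=> xm; rewrite -A3 // -B3.
- by move=> xm; rewrite -A4 // -B4.
Qed.

Lemma same_run c s : same c s (run c s).
Proof.
elim: c s => [p|c1 IH1 c2 IH2|b c1 IH1 c2 IH2|i b c IH] s.
- by case: p => *; split=> //= x; rewrite inE => /negbTE ->.
- have [A1 A2 A3 A4] := IH1 s; have [B1 B2 B3 B4] := IH2 (run c1 s).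
  split=> x /=; rewrite mem_cat negb_or => /andP[? ?].
  + by rewrite B1 // A1.
  + by rewrite B2 // A2.
  + by rewrite B3 // A3.
  + by rewrite B4 // A4.
- have [A1 A2 A3 A4] := IH1 s; have [B1 B2 B3 B4] := IH2 s.
  split=> x /=; rewrite mem_cat negb_or => /andP[? ?]; case: ifP => _;
  by [rewrite A1|rewrite A2|rewrite A3|rewrite A4|rewrite B1|rewrite B2|rewrite B3|rewrite B4].
- exact: iteri_same.
Qed.

Lemma wf_imods L c x : wf L c -> x \in L -> x \notin imods c.
Proof.
elim: c => [p|c1 IH1 c2 IH2|b c1 IH1 c2 IH2|i b c IH] /=.
- by move=> /andP[_ /allP H] xL; apply/negP => /H /=; rewrite xL.
- by move=> /andP[/IH1 H1 /IH2 H2] xL; rewrite mem_cat negb_or H1 // H2.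
- by move=> /andP[/IH1 H1 /IH2 H2] xL; rewrite mem_cat negb_or H1 // H2.
- move=> /and4P[iL bL _ /IH H] xL; rewrite in_cons negb_or H // andbT.
  by apply: contraNneq iL => <-.
Qed.

(** [rho] holds the values of the registers in [L], which [wf] keeps constant. Hence the bounds of
    inner loops are known before the outer loop starts, and the time can be evaluated at the initial
    state. *)
Lemma exec L rho c E t K s :
  wf L c -> reg1 \in L -> rho reg1 = 1%N ->
  (forall x, x \in L -> ireg s x = rho x) ->
  halts_with E t K (run c s) <= halts_with E (btime rho c + t) (compile c :: K) s.
Proof.
move=> + reg1L rho1.
elim: c t K s => [p|c1 IH1 c2 IH2|b c1 IH1 c2 IH2|i b c IH] t K s.
- by move=> /andP[? _] _; rewrite halts_prim.
- move=> /andP[w1 w2] Ls.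
  rewrite [btime _ _]/= addSn [compile _]/= halts_seq [run _ _]/=.
  apply: le_trans (IH2 t K _ w2 _) _.
    by move=> x xL; rewrite (sameI (same_run c1 s)) ?Ls // (wf_imods w1).
  by apply: le_trans (IH1 _ _ _ w1 Ls) _; rewrite addnA.
- move=> /andP[w1 w2] Ls.
  rewrite [btime _ _]/= addSn [compile _]/= halts_ite [run _ _]/=; case: ifP => _.
  + apply: le_trans (IH1 t K s w1 Ls) _; apply: halts_mono.
    by rewrite leq_add2r leq_addr.
  + apply: le_trans (IH2 t K s w2 Ls) _; apply: halts_mono.
    by rewrite leq_add2r leq_addl.
- move=> /and4P[iL bL ic wc] Ls.
  rewrite [compile _]/= [run _ _]/= Ls //.
  set W := While _ _; set F := fun p s' => _.
  have st p : [/\ ireg (iteri p F (set_ireg s i 0)) i = p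
      & forall x, x \in L -> ireg (iteri p F (set_ireg s i 0)) x = rho x].
    split; first by case: p => [|p] /=; rewrite eqxx.
    move=> x xL.
    have := iteri_same i b s p (same_run c) => /sameI -> /=; first exact: Ls.
    rewrite in_cons negb_or (wf_imods wc) // andbT.
    by apply: contraNneq iL => <-.
  (* Generalized to [p] rounds done and [r] rounds left, for an induction on [r]. *)
  suff main r p : (r + p)%N = rho b ->
    halts_with E t K (iteri (rho b) F (set_ireg s i 0)) <=
    halts_with E (r * (btime rho c + 3) + 1 + t) (W :: K) (iteri p F (set_ireg s i 0)).
    apply: le_trans (main _ 0%N (addn0 _)) _.
    have -> : (btime rho (CFor i b c) + t =
      (rho b * (btime rho c + 3) + 1 + t).+2)%N by rewrite /=; lia.
    by rewrite halts_seq halts_prim.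
  elim: r p => [|r IHr] p rp; have [e1 e2] := st p.
    by rewrite mul0n add0n add1n halts_while [eval_test _ _]/= e1 e2 // -rp ltnn.
  have -> : (r.+1 * (btime rho c + 3) + 1 + t =
    (btime rho c + (r * (btime rho c + 3) + 1 + t).+1).+2)%N.
    by rewrite mulSn; lia.
  rewrite halts_while [eval_test _ _]/= e1 e2 // (_ : (p < rho b)%N); last by rewrite -rp; lia.
  rewrite halts_seq.
  apply: le_trans (IH _ _ _ wc e2); rewrite halts_prim //.
  have -> : step (IAdd i i reg1) (run c (iteri p F (set_ireg s i 0))) =
    iteri p.+1 F (set_ireg s i 0).
    rewrite /= {2}/F; set s1 := run c _.
    have -> : ireg s1 i = p by rewrite (sameI (same_run _ _)).
    have -> : ireg s1 reg1 = 1%N by rewrite (sameI (same_run _ _)) ?e2 // (wf_imods wc).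
    by rewrite addn1.
  by apply: IHr; rewrite addnS -addSn.
Qed.

(** The value of the counter and the frame of the whole loop are supplied at every round, so an
    invariant has to mention only what the body changes. *)
Lemma for_ind (I : nat -> state R -> Prop) i b c s :
  I 0%N (set_ireg s i 0) ->
  (forall p s', (p < ireg s b)%N -> ireg s' i = p -> same (CFor i b c) s s' ->
     I p s' -> I p.+1 (set_ireg (run c s') i p.+1)) ->
  I (ireg s b) (run (CFor i b c) s).
Proof.
move=> I0 IS /=.
elim: {-2}(ireg s b) (leqnn (ireg s b)) => [//|p IH] lp /=.
apply: IS => //; [by case: (p) => [|q] /=; rewrite eqxx|exact: iteri_same (same_run c)|].
exact/IH/ltnW.
Qed.

End Machine.

(** * The Euclidean norm *)

Section Norm.
Variables (R : realType) (d : nat).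
Implicit Types u v : 'rV[R]_d.

Definition sqn v : R := \sum_(j < d) v ord0 j ^+ 2.

Lemma sqn_ge0 v : 0 <= sqn v.
Proof. by apply: sumr_ge0 => j _; rewrite sqr_ge0. Qed.

Lemma l2norm_ge0 v : 0 <= l2norm v. Proof. exact: sqrtr_ge0. Qed.

Lemma l2norm_sqr v : l2norm v ^+ 2 = sqn v.
Proof. by rewrite sqr_sqrtr // sqn_ge0. Qed.

Lemma l2normN v : l2norm (- v) = l2norm v.
Proof. by congr Num.sqrt; apply: eq_bigr => j _; rewrite mxE sqrrN. Qed.

Lemma sqnZ c v : sqn (c *: v) = c ^+ 2 * sqn v.
Proof. by rewrite /sqn mulr_sumr; apply: eq_bigr => j _; rewrite mxE exprMn. Qed.

Lemma sqnD u v :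
  sqn (u + v) = sqn u + 2 * (\sum_(j < d) u ord0 j * v ord0 j) + sqn v.
Proof.
rewrite /sqn mulr_sumr -!big_split /=; apply: eq_bigr => j _.
by rewrite mxE; ring.
Qed.

Lemma cauchy_schwarz u v :
  (\sum_(j < d) u ord0 j * v ord0 j) ^+ 2 <= sqn u * sqn v.
Proof.
set p := \sum_(j < d) _.
have [v0|v0] := eqVneq (sqn v) 0.
  rewrite v0 mulr0 /p big1 ?expr0n // => j _.
  have : v ord0 j ^+ 2 = 0 by apply: (psumr_eq0P _ v0) => // i _; apply: sqr_ge0.
  by move/eqP; rewrite sqrf_eq0 => /eqP ->; rewrite mulr0.
have vp : 0 < sqn v by rewrite lt_def v0 sqn_ge0.
(* The component of [u] orthogonal to [v], multiplied by [sqn v] to avoid a division. *)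
have := sqn_ge0 (sqn v *: u + (- p) *: v).
rewrite sqnD !sqnZ.
have -> : \sum_(j < d) (sqn v *: u) ord0 j * (- p *: v) ord0 j =
    (- p * sqn v) * \sum_(j < d) u ord0 j * v ord0 j.
  by rewrite mulr_sumr; apply: eq_bigr => j _; rewrite !mxE; ring.
rewrite -/p.
have -> : sqn v ^+ 2 * sqn u + 2 * (- p * sqn v * p) + (- p) ^+ 2 * sqn v =
  sqn v * (sqn u * sqn v - p ^+ 2) by ring.
by rewrite pmulr_rge0 // subr_ge0.
Qed.

Lemma l2normD u v : l2norm (u + v) <= l2norm u + l2norm v.
Proof.
rewrite -ler_sqr ?nnegrE ?addr_ge0 ?l2norm_ge0 //.
rewrite sqrrD !l2norm_sqr sqnD -(mulr_natl (_ * _) 2) lerD2r lerD2l ler_pM2l //.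
apply: le_trans (ler_norm _) _.
rewrite -ler_sqr ?nnegrE ?mulr_ge0 ?l2norm_ge0 //.
by rewrite real_normK ?num_real // exprMn !l2norm_sqr cauchy_schwarz.
Qed.

Lemma l2normB u v w : l2norm (u - w) <= l2norm (u - v) + l2norm (v - w).
Proof. by apply: le_trans (l2normD _ _); rewrite addrA subrK. Qed.

Lemma l2norm_sym u v : l2norm (u - v) = l2norm (v - u).
Proof. by rewrite -l2normN opprB. Qed.

End Norm.

(** * Center proximity leaves room for approximate centers *)

Lemma fin_pos_lb (R : realType) (T : finType) (F : T -> R) :
  (forall t, 0 < F t) -> exists2 tau, 0 < tau & forall t, tau <= F t.
Proof.
move=> F0; exists (\big[Num.min/1]_t F t); first by apply: lt_bigmin => //; rewrite ltr01.
by move=> t; apply: bigmin_le.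
Qed.

Section Separation.
Variables (R : realType) (k n d : nat) (X : 'I_n -> 'rV[R]_d).
Variables (alpha : R) (mu : 'I_k -> 'rV[R]_d) (f : 'I_n -> option 'I_k).
Hypothesis alpha12 : 1 < alpha < 2.
Hypothesis prox : center_proximity X alpha mu f.
Hypothesis ne : forall j, exists x, x \in cluster f j.

Let a x i := l2norm (X x - mu i).

(** The witness is [delta * r j + tau / 3] with [r j] the radius of cluster [j]. The first term
    serves the variance bound: the squared deviations sum to at most [#|cluster f j| * r j ^ 2], and
    [2 <= m * delta ^ 2] is the hypothesis on [m], since [delta ^ 2] is [(alpha - 1) ^ 4 / 36]. The
    second term keeps [e j] positive when all points of a cluster coincide. *)
Lemma separation (m : nat) : 72 <= m%:R * (alpha - 1) ^+ 4 ->
  exists e : 'I_k -> R, [/\ forall j, 0 < e j,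
    forall j, 2 * (\sum_(x in cluster f j) sqn (X x - mu j)) <=
      m%:R * #|cluster f j|%:R * e j ^+ 2,
    forall i j x, i != j -> x \in cluster f i -> a x i + e i + e j < a x j
  & forall i j x y, x \in cluster f i -> y \in outliers f ->
      a x i + e i + e j < a y j].
Proof.
move=> mP; case/andP: alpha12 => a1 a2; have [pr1 pr2] := prox.
have topP j : exists x, x \in cluster f j /\
    forall y, y \in cluster f j -> a y j <= a x j.
  have [x0 x0P] := ne j.
  exists [arg max_(x > x0 in cluster f j) a x j]%O.
  by case: arg_maxP => // x xj xm; split => // y /xm.
have {topP} [top topP] := choice topP.
pose r j := a (top j) j.
have rE j : r j = a (top j) j by [].
have r0 j : 0 <= r j by apply: l2norm_ge0.
pose delta := (alpha - 1) ^+ 2 / 6.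
have d0 : 0 < delta by rewrite divr_gt0 // exprn_gt0 // subr_gt0.
have da : 2 * delta <= alpha - 1 by rewrite /delta; nra.
(* Proximity at the farthest point of a cluster gives [(alpha - 1) * r < D] for both radii, and
   [D <= a x i + a x j]. The inequality [h1] is [alpha * a x i < a x j] rearranged. The bound
   [alpha < 2] enters as [alpha + 1 <= 3], which matches the 6 in [delta]. *)
have s1 i j x : i != j -> x \in cluster f i ->
    0 < a x j - a x i - delta * (r i + r j).
  move=> ij xi; have b1 := pr1 i j x ij xi; rewrite -!/(a _ _) in b1.
  pose D := l2norm (mu i - mu j).
  have rD p q : p != q -> l2norm (mu p - mu q) = D -> (alpha - 1) * r p < D.
    move=> pq Dpq; have := pr1 p q (top p) pq (topP p).1.
    have := l2normB (X (top p)) (mu p) (mu q); rewrite Dpq -!/(a _ _) -rE; lra.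
  have ri := rD i j ij erefl.
  have rj := rD j i; rewrite eq_sym in rj.
  have {rj} rj := rj ij (l2norm_sym _ _).
  have DD : D <= a x i + a x j.
    by rewrite /a (l2norm_sym (X x)) l2normB.
  have x0 : 0 <= a x i by apply: l2norm_ge0.
  have h1 : (alpha - 1) * (a x i + a x j) < (alpha + 1) * (a x j - a x i) by lra.
  have h2 : delta * (r i + r j) <= (alpha - 1) * D / 3.
    have -> : delta * (r i + r j) =
      (alpha - 1) * ((alpha - 1) * r i + (alpha - 1) * r j) / 6.
      by rewrite /delta; field.
    nra.
  have h3 : (alpha - 1) * D <= (alpha - 1) * (a x i + a x j) by nra.
  have h4 : 0 < a x j - a x i by nra.
  have h5 : (alpha + 1) * (a x j - a x i) <= 3 * (a x j - a x i) by nra.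
  lra.
(* The distance [a y j] exceeds [alpha] times the larger of [r i] and [r j], while [a x i <= r i];
   so the gap is at least [alpha - 1], hence [2 * delta], times that larger radius. *)
have s2 i j x y : x \in cluster f i -> y \in outliers f ->
    0 < a y j - a x i - delta * (r i + r j).
  move=> xi yZ.
  have h0 := pr2 i j x y xi yZ.
  have h1 := pr2 i j (top i) y (topP i).1 yZ.
  have h2 := pr2 j j (top j) y (topP j).1 yZ.
  rewrite -!/(a _ _) -?rE in h0 h1 h2.
  have := (topP i).2 x xi; rewrite -rE => h3.
  have ri := r0 i; have rj := r0 j; have x0 : 0 <= a x i by apply: l2norm_ge0.
  have [?|?] := leP (r i) (r j); nra.
(* Finitely many strict inequalities have a common margin [tau]; tuples outside their premises get
   the value 1. Two shares of [tau / 3] stay strictly below the margin. *)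
pose T := ('I_k * 'I_k * 'I_n * 'I_n)%type.
pose F (t : T) := let: (i, j, x, y) := t in
  Num.min (if (i != j) && (x \in cluster f i)
           then a x j - a x i - delta * (r i + r j) else 1)
          (if (x \in cluster f i) && (y \in outliers f)
           then a y j - a x i - delta * (r i + r j) else 1).
have [|tau tau0 tauP] := @fin_pos_lb _ _ F.
  move=> [[[i j] x] y]; rewrite /F lt_min; apply/andP; split.
    by case: ifP => // /andP[/s1 h /h].
  by case: ifP => // /andP[/s2 h /h].
exists (fun j => delta * r j + tau / 3); split.
- by move=> j; have := r0 j; nra.
- move=> j; have rj := r0 j.
  apply: le_trans (_ : m%:R * #|cluster f j|%:R * (delta * r j) ^+ 2 <= _); last first.
    apply: ler_wpM2l; first by rewrite mulr_ge0.
    by rewrite ler_sqr ?nnegrE; nra.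
  apply: le_trans (_ : 2 * (#|cluster f j|%:R * r j ^+ 2) <= _).
    rewrite ler_pM2l // mulr_natl -sumr_const; apply: ler_sum => x xj.
    rewrite -l2norm_sqr ler_sqr ?nnegrE ?l2norm_ge0 //.
    exact: (topP j).2.
  have -> : m%:R * #|cluster f j|%:R * (delta * r j) ^+ 2 =
    (m%:R * (alpha - 1) ^+ 4 / 36) * (#|cluster f j|%:R * r j ^+ 2).
    by rewrite /delta; field.
  apply: ler_wpM2r; first by rewrite mulr_ge0 ?sqr_ge0.
  lra.
- move=> i j x ij xi; have := tauP (i, j, x, x).
  by rewrite /F le_min ij xi /= => /andP[+ _]; lra.
- move=> i j x y xi yZ; have := tauP (i, j, x, y).
  by rewrite /F le_min xi yZ /= => /andP[_]; lra.
Qed.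

Variables (mu' : 'I_k -> 'rV[R]_d) (e : 'I_k -> R).
Hypothesis close : forall j, l2norm (mu' j - mu j) <= e j.
Hypothesis sep1 :
  forall i j x, i != j -> x \in cluster f i -> a x i + e i + e j < a x j.
Hypothesis sep2 : forall i j x y, x \in cluster f i -> y \in outliers f ->
      a x i + e i + e j < a y j.

(** Each center moves by at most its own [e], so two triangle inequalities use up exactly the slack
    [e i + e j]. *)
Lemma close_sqn_lt i j x y : a x i + e i + e j < a y j ->
  sqn (X x - mu' i) < sqn (X y - mu' j).
Proof.
move=> h; rewrite -!l2norm_sqr ltr_sqr ?nnegrE ?l2norm_ge0 //.
have := l2normB (X x) (mu i) (mu' i); rewrite (l2norm_sym (mu i)).
have := l2normB (X y) (mu' j) (mu j).
have := close i; have := close j; rewrite /a in h; lra.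
Qed.

Lemma close_cluster i j x : i != j -> x \in cluster f i ->
  sqn (X x - mu' i) < sqn (X x - mu' j).
Proof. by move=> ij xi; apply/close_sqn_lt/sep1. Qed.

Lemma close_outlier i j x y : x \in cluster f i -> y \in outliers f ->
  sqn (X x - mu' i) < sqn (X y - mu' j).
Proof. by move=> xi yZ; apply/close_sqn_lt/sep2. Qed.

End Separation.

(** * Uniform samples and their mean *)

Section Expectation.
Variables (R : realType) (n : nat).
Implicit Types G : seq 'I_n -> R.

(** Expectation over [r] independent uniform indices. The recursion has the shape of the semantics
    of [Draw], so the sampling loop unfolds to it one draw at a time. *)
Fixpoint Ex (r : nat) G : R :=
  if r is r'.+1 then (\sum_(x < n) Ex r' (fun v => G (x :: v))) / n%:R
  else G [::].

Lemma le_Ex r G G' : (forall u, size u = r -> G u <= G' u) -> Ex r G <= Ex r G'.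
Proof.
elim: r G G' => [|r IH] G G' le; first exact: le.
rewrite /= ler_wpM2r ?invr_ge0 ?ler0n //.
by apply: ler_sum => x _; apply: IH => u su; apply: le; rewrite /= su.
Qed.

Lemma eq_Ex r G G' : (forall u, size u = r -> G u = G' u) -> Ex r G = Ex r G'.
Proof.
by move=> e; apply/eqP; rewrite eq_le !le_Ex // => u /e ->.
Qed.

Lemma ExD r1 r2 G : Ex (r1 + r2) G = Ex r1 (fun u => Ex r2 (fun v => G (u ++ v))).
Proof.
elim: r1 G => [|r1 IH] G //=; congr (_ / _).
by apply: eq_bigr => x _; rewrite IH.
Qed.

Lemma ExZ r c G : Ex r (fun u => c * G u) = c * Ex r G.
Proof.
elim: r G => [|r IH] G //=; rewrite mulrA; congr (_ / _).
by rewrite mulr_sumr; apply: eq_bigr => x _; rewrite IH.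
Qed.

Lemma Ex0 r : Ex r (fun=> 0) = 0.
Proof. by elim: r => //= r ->; rewrite sumr_const mul0rn mul0r. Qed.

Lemma Ex_ge0 r G : (forall u, 0 <= G u) -> 0 <= Ex r G.
Proof. by move=> G0; rewrite -(Ex0 r) le_Ex. Qed.

Fixpoint blocks (m k : nat) (gb : nat -> seq 'I_n -> bool) (u : seq 'I_n) : bool :=
  if k is k'.+1 then gb 0%N (take m u) && blocks m k' (gb \o succn) (drop m u)
  else true.

Lemma blocksP m k gb u : blocks m k gb u ->
  forall j, (j < k)%N -> gb j (take m (drop (j * m) u)).
Proof.
elim: k gb u => [|k IH] gb u //= /andP[g0 /IH gS] [|j] jk.
  by rewrite mul0n drop0.
by have := gS j jk; rewrite drop_drop mulSn addnC.
Qed.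

(** Independence of disjoint blocks: [ExD] turns the expectation into an iterated one, through which
    the product of two indicators factors. *)
Lemma Ex_blocks m k (gb : nat -> seq 'I_n -> bool) (p : R) : 0 <= p ->
  (forall j, (j < k)%N -> p <= Ex m (fun v => (gb j v)%:R)) ->
  p ^+ k <= Ex (k * m) (fun u => (blocks m k gb u)%:R).
Proof.
move=> p0; elim: k gb => [|k IH] gb gp; first by rewrite expr0.
rewrite mulSn ExD exprS.
apply: le_trans (_ : p * Ex (k * m) (fun u => (blocks m k (gb \o succn) u)%:R) <= _).
  by apply: ler_wpM2l => //; apply: IH => j jk; apply: gp.
apply: le_trans (_ : Ex m (fun u => (gb 0%N u)%:R *
  Ex (k * m) (fun u => (blocks m k (gb \o succn) u)%:R)) <= _); last first.
  apply: le_Ex => u su; rewrite -ExZ; apply: le_Ex => v sv /=.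
  by rewrite -natrM mulnb take_size_cat // drop_size_cat.
set c := Ex (k * m) _.
rewrite (@eq_Ex m _ (fun u => c * (gb 0%N u)%:R)) => [|u _]; last by rewrite mulrC.
rewrite ExZ mulrC ler_wpM2l ?gp //.
by apply: Ex_ge0 => u; rewrite ler0n.
Qed.

Variables (d : nat) (X : 'I_n -> 'rV[R]_d) (C : {set 'I_n}) (mu : 'rV[R]_d).
Hypothesis C0 : (0 < #|C|)%N.
Hypothesis muP : mu = #|C|%:R^-1 *: \sum_(x in C) X x.

Let cC : #|C|%:R != 0 :> R. Proof. by rewrite pnatr_eq0 -lt0n. Qed.

Let dev : \sum_(x in C) (X x - mu) = 0.
Proof.
rewrite sumrB sumr_const {1}muP -scaler_nat scalerA mulfV // scale1r.
by rewrite subrr.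
Qed.

Let var := \sum_(x in C) sqn (X x - mu).

Lemma sum_sqnD S : \sum_(x in C) sqn (S + (X x - mu)) = #|C|%:R * sqn S + var.
Proof.
under eq_bigr do rewrite sqnD.
rewrite !big_split /= sumr_const -(mulr_natl (sqn S)) -/var; congr (_ + _).
rewrite -[RHS]addr0; congr (_ + _).
rewrite -mulr_sumr exchange_big /= big1 ?mulr0 // => l _.
rewrite -mulr_sumr.
have -> : \sum_(x in C) (X x - mu) ord0 l = (\sum_(x in C) (X x - mu)) ord0 l.
  by rewrite summxE.
by rewrite dev mxE mulr0.
Qed.

(** The partial sum [S] is carried along to make the induction work; cross terms vanish because
    deviations from the mean sum to zero over [C]. The integrand is later a lower bound for the
    indicator of a close sample mean: for [Q] the square of [m * e] it is at most 1, and nonpositive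
    when the mean is farther than [e]. *)
Lemma Ex_second_moment (Q : R) r S :
  Ex r (fun v => (all (mem C) v)%:R *
      (1 - sqn (S + \sum_(x <- v) (X x - mu)) / Q)) =
  (#|C|%:R / n%:R) ^+ r * (1 - (sqn S + r%:R * (var / #|C|%:R)) / Q).
Proof.
elim: r S => [|r IH] S /=; first by rewrite big_nil addr0 mul0r addr0 expr0.
have -> : \sum_(x < n) Ex r (fun v : seq 'I_n =>
      ((x \in C) && all (mem C) v)%:R *
      (1 - sqn (S + \sum_(x0 <- (x :: v)) (X x0 - mu)) / Q)) =
   \sum_(x in C) ((#|C|%:R / n%:R) ^+ r *
      (1 - (sqn (S + (X x - mu)) + r%:R * (var / #|C|%:R)) / Q)).
  rewrite [RHS]big_mkcond /=; apply: eq_bigr => x _; case: ifP => xC.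
    by rewrite -IH; apply: eq_Ex => v _; rewrite big_cons addrA.
  by rewrite -[RHS](Ex0 r); apply: eq_Ex => v _; rewrite mul0r.
rewrite -mulr_sumr sumrB sumr_const -mulr_suml big_split /= sum_sqnD.
rewrite sumr_const -(mulr_natl (_ * _)) exprS.
rewrite -[in RHS](natr1 r).
set q := _ ^+ r; set c := #|C|%:R.
have cc : c * (var / c) = var by rewrite mulrC mulfVK.
have -> : c * sqn S + var + c * (r%:R * (var / c)) =
  c * (sqn S + (r%:R + 1) * (var / c)).
  by rewrite -{1}cc; ring.
by ring.
Qed.

(* Chebyshev's inequality, conditioned on all m samples lying in C. *)
Lemma Ex_mean_close (m : nat) (e : R) : (0 < m)%N -> 0 < e ->
  2 * var <= m%:R * #|C|%:R * e ^+ 2 ->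
  (#|C|%:R / n%:R) ^+ m / 2 <=
  Ex m (fun v => (l2norm (m%:R^-1 *: \sum_(x <- v) X x - mu) <= e)%R%:R).
Proof.
move=> m0 e0 ve.
have m0' : 0 < m%:R :> R by rewrite ltr0n.
have c0 : 0 < #|C|%:R :> R by rewrite ltr0n.
have Q0 : 0 < (m%:R * e) ^+ 2 by rewrite exprn_gt0 // mulr_gt0.
apply: le_trans (_ : Ex m (fun v => (all (mem C) v)%:R *
      (1 - sqn (0 + \sum_(x <- v) (X x - mu)) / (m%:R * e) ^+ 2)) <= _).
  rewrite Ex_second_moment ler_wpM2l ?exprn_ge0 ?divr_ge0 //.
  rewrite -(scale0r 0) sqnZ expr0n mul0r add0r.
  rewrite lerBrDl -lerBrDr ler_pdivrMr //.
  have -> : m%:R * (var / #|C|%:R) = m%:R * var / #|C|%:R by rewrite mulrA.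
  rewrite ler_pdivrMr //; nra.
apply: le_Ex => v sv; rewrite add0r.
have -> : \sum_(x <- v) (X x - mu) = m%:R *: (m%:R^-1 *: \sum_(x <- v) X x - mu).
  rewrite scalerBr scalerA mulfV ?gt_eqF // scale1r sumrB; congr (_ - _).
  by rewrite big_const_seq count_predT sv iter_addr_0 scaler_nat.
rewrite sqnZ exprMn -mulf_div mulfV ?gt_eqF ?exprn_gt0 // mul1r -l2norm_sqr.
have [h|h] := leP (l2norm (m%:R^-1 *: \sum_(x <- v) X x - mu)) e.
  apply: le_trans (_ : (all (mem C) v)%:R * 1 <= _); last by rewrite mulr1 ler_nat leq_b1.
  by rewrite ler_wpM2l // gerBl divr_ge0 ?sqr_ge0.
rewrite mulr_ge0_le0 // subr_le0 ler_pdivlMr ?exprn_gt0 // mul1r.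
by rewrite ler_sqr ?nnegrE ?l2norm_ge0 ?ltW.
Qed.

End Expectation.

(** * Program pieces: row offsets, sample labels and means *)

Arguments run : simpl never.
Arguments btime : simpl never.

(* Integer arrays: 0 the best labelling so far, 1 current labels, 2 indices of
   the points to average (the samples, or all points), 3 row offsets i * d.
   Real arrays: 1 centers, 2 squared distances point-center (row-major),
   3 squared distance to the nearest center, 4 to 6 work space of selection.
   Register 9 is the number of points to average, 7 tells whether array 0 is
   filled; real register 2 is the cost of the labelling in array 0, 3 the
   threshold above which points are outliers. *)
Notation "c1 ;; c2" := (CSeq c1 c2) (at level 60, right associativity).

(** There is no empty instruction; register 28 is never read. *)
Definition skip := Prim (ISet 28 0).
Definition IfEq x y c := CIte (ILt x y) skip (CIte (ILt y x) skip c).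

(** Integers cannot be multiplied, yet sampled points need random access to their rows; hence a
    table of offsets filled by additions. *)
Definition p_row :=
  Prim (ISet 14 0) ;;
  CFor 10 1 (Prim (IStore 3 10 14) ;; Prim (IAdd 14 14 2)).

(** Sample [p] is reserved for cluster [p %/ m]. With this labelling the code that averages the
    clusters of a full labelling also averages the blocks of samples. *)
Definition p_labels :=
  Prim (ISet 9 0) ;;
  CFor 10 0 (CFor 11 8 (Prim (IStore 1 9 10) ;; Prim (IAdd 9 9 reg1))).

Definition p_mean_acc :=
  CFor 12 9 (Prim (ILoad 18 1 12) ;;
    IfEq 18 10 (Prim (ILoad 17 2 12) ;; Prim (ILoad 17 3 17) ;;
      Prim (IAdd 17 17 11) ;; Prim (RLoad 7 0 17) ;; Prim (ROp RAdd 6 6 7) ;;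
      Prim (IAdd 19 19 reg1))).

(** The real zero is obtained as [x - x], since there are no real literals. An empty cluster gets
    the mean 0, in agreement with [cluster_mean]. *)
Definition p_mean_coord :=
  Prim (ISet 19 0) ;; Prim (ROp RSub 6 6 6) ;; p_mean_acc ;;
  Prim (ROfI 7 19) ;; Prim (ROp RDiv 6 6 7) ;; Prim (RStore 1 14 6) ;;
  Prim (IAdd 14 14 reg1).

Definition p_means :=
  Prim (ISet 14 0) ;; CFor 10 0 (CFor 11 2 p_mean_coord).

Lemma mulnD_inj d a b j l : (b < d)%N -> (l < d)%N ->
  (a * d + b = j * d + l)%N -> a = j /\ b = l.
Proof.
move=> bd ld e; have := congr1 (divn^~ d) e.
rewrite !divnMDl ?(leq_ltn_trans _ bd) // !divn_small // !addn0 => aj.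
by split => //; move: e; rewrite aj => /addnI.
Qed.

Lemma mulnD_lt d n i j : (i < n)%N -> (j < d)%N -> (i * d + j < n * d)%N.
Proof. by nia. Qed.

Section Pieces.
Variable R : realType.
Implicit Types s : state R.

Lemma runS c1 c2 s : run (c1 ;; c2) s = run c2 (run c1 s). Proof. by []. Qed.
Lemma runP p s : run (Prim p) s = step p s. Proof. by []. Qed.
Lemma runI b c1 c2 s :
  run (CIte b c1 c2) s = if eval_test b s then run c1 s else run c2 s.
Proof. by []. Qed.
Lemma runEq x y c s : run (IfEq x y c) s =
  if ireg s x == ireg s y then run c s else run skip s.
Proof. by rewrite /IfEq !runI /=; case: ltngtP. Qed.

Definition runE := (runS, runP, runEq, runI).

Lemma p_rowP s i : (i < ireg s 1)%N ->
  iarr (run p_row s) 3 i = (i * ireg s 2)%N.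
Proof.
rewrite /p_row runS runP; set s0 := step _ s.
pose I p s' := ireg s' 14 = (p * ireg s 2)%N /\
  forall i, (i < p)%N -> iarr s' 3 i = (i * ireg s 2)%N.
suff : I (ireg s0 1) (run (CFor 10 1 (Prim (IStore 3 10 14);; Prim (IAdd 14 14 2))) s0).
  by case=> _; apply.
apply: for_ind; first by split.
move=> p s' _ e S [I1 I2]; rewrite !runE; split => [/=|j jp /=].
  by rewrite I1 (sameI S) // mulSn addnC.
rewrite e I1; case: eqP => [->//|/eqP ne]; apply: I2; lia.
Qed.

Lemma p_labelsP s : (ireg s 4 = 1)%N -> let s' := run p_labels s in
  ireg s' 9 = (ireg s 0 * ireg s 8)%N /\
  forall p, (p < ireg s 0 * ireg s 8)%N -> iarr s' 1 p = (p %/ ireg s 8)%N.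
Proof.
move=> e1; rewrite /p_labels runS runP; set s0 := step _ s.
pose I j t s' := ireg s' 9 = (j * ireg s 8 + t)%N /\
  forall p, (p < j * ireg s 8 + t)%N -> iarr s' 1 p = (p %/ ireg s 8)%N.
suff : I (ireg s0 0) 0%N (run (CFor 10 0 (CFor 11 8 (Prim (IStore 1 9 10);; Prim (IAdd 9 9 reg1)))) s0).
  by rewrite /I addn0.
apply: (@for_ind _ (fun p => I p 0%N)); first by split.
move=> j s1 jk e S [I1 I2].
set c := CFor 11 _ _.
have : I j (ireg s1 8) (run c s1).
  apply: for_ind => [|t s2]; first by split.
  rewrite (sameI S) // => tm e2 S2 [J1 J2]; rewrite !runE; split => [/=|p pt /=].
    by rewrite J1 (sameI S2) // (sameI S) //= e1 addn1 addnS.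
  rewrite J1 (sameI S2) //=; case: eqP => [->|/eqP ne].
    by rewrite divnMDl ?(leq_trans _ tm) // divn_small // addn0 e.
  by apply: J2; move: pt ne; lia.
rewrite (sameI S) //; case=> K1 K2.
by rewrite /I addn0 mulSn addnC.
Qed.

Lemma p_mean_accP s : (ireg s 4 = 1)%N -> let s' := run p_mean_acc s in
  ireg s' 19 = (ireg s 19 + \sum_(p < ireg s 9) (iarr s 1 p == ireg s 10))%N /\
  rreg s' 6 = rreg s 6 + \sum_(p < ireg s 9 | iarr s 1 p == ireg s 10)
     rarr s 0 (iarr s 3 (iarr s 2 p) + ireg s 11)%N.
Proof.
move=> e1.
pose I q s' :=
  ireg s' 19 = (ireg s 19 + \sum_(p < q) (iarr s 1 p == ireg s 10))%N /\
  rreg s' 6 = rreg s 6 + \sum_(p < q) if iarr s 1 p == ireg s 10 then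
     rarr s 0 (iarr s 3 (iarr s 2 p) + ireg s 11)%N else 0.
suff [I1 I2] : I (ireg s 9) (run p_mean_acc s).
  by split; rewrite // [in RHS]big_mkcond.
apply: for_ind; first by rewrite /I !big_ord0 addn0 addr0.
move=> q s' qN e S [I1 I2]; rewrite !runE /I !big_ord_recr /= e.
rewrite (sameIA S) // (sameI S) //; case: ifP => h /=.
  rewrite I1 I2 !(sameI S) // e1 !(sameIA S) // (sameRA S) //.
  by rewrite addnA addrA.
by rewrite I1 I2 addn0 addr0.
Qed.

(** All cells before the write pointer [j * d + l] are final. A finished row [(j, d)] is the start
    [(j + 1, 0)] of the next, and [mulnD_inj] separates the new cell from the old ones. *)
Lemma p_meansP s j l : (ireg s 4 = 1)%N -> (j < ireg s 0)%N -> (l < ireg s 2)%N ->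
  rarr (run p_means s) 1 (j * ireg s 2 + l)%N =
  (\sum_(p < ireg s 9 | iarr s 1 p == j) rarr s 0 (iarr s 3 (iarr s 2 p) + l)%N)
  / (\sum_(p < ireg s 9) (iarr s 1 p == j))%:R.
Proof.
move=> e1 jk ld; rewrite /p_means runS runP; set s0 := step _ s.
pose V j l := (\sum_(p < ireg s 9 | iarr s 1 p == j) rarr s 0 (iarr s 3 (iarr s 2 p) + l)%N)
  / (\sum_(p < ireg s 9) (iarr s 1 p == j))%:R.
pose d := ireg s 2.
pose I j l s' := ireg s' 14 = (j * d + l)%N /\
  forall a b, (b < d)%N -> (a * d + b < j * d + l)%N -> rarr s' 1 (a * d + b)%N = V a b.
suff : I (ireg s 0) 0%N (run (CFor 10 0 (CFor 11 2 p_mean_coord)) s0).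
  by case=> _; apply => //; rewrite addn0 -/d; nia.
apply: (@for_ind _ (fun p => I p 0%N)); first by split.
move=> {jk ld} {}j s1 jk e S [I1 I2].
set c := CFor 11 _ _.
have : I j (ireg s1 2) (run c s1).
  apply: for_ind => [|{}l s2]; first by split.
  rewrite (sameI S) // => ld e2 S2 [J1 J2]; rewrite /p_mean_coord !runE.
  set s3 := step _ (step _ s2); have S3 := same_run p_mean_acc s3.
  have [|A1 A2] := @p_mean_accP s3.
    by rewrite /= (sameI S2) // (sameI S).
  rewrite /= subrr add0r add0n (sameI S2) // (sameI S) //= in A1 A2.
  rewrite (sameIA S2) // (sameIA S) //= in A1 A2.
  rewrite e2 (sameI S2) // e !(sameIA S2) // !(sameIA S) // (sameRA S2) // (sameRA S) // in A1 A2.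
  rewrite /I /= (sameI S3) // (sameI S3) //= J1 (sameI S2) // (sameI S) //= e1 addn1 addnS.
  split=> // a b bd ab; rewrite A1 A2.
  case: eqP => [E|/eqP ne].
    have [-> ->] : a = j /\ b = l by apply: (@mulnD_inj d).
    by [].
  rewrite (sameRA S3) //=; apply: J2; rewrite //; move: ab ne; rewrite -/d; lia.
rewrite (sameI S) //; case=> K1 K2.
by rewrite /I addn0 mulSn addnC; split.
Qed.

End Pieces.

(** * Program pieces: distances, labelling, admissibility check, update *)

Definition p_dist_acc :=
  CFor 12 2 (Prim (IAdd 17 15 12) ;; Prim (RLoad 7 0 17) ;;
    Prim (RLoad 8 1 16) ;; Prim (ROp RSub 7 7 8) ;; Prim (ROp RMul 7 7 7) ;;
    Prim (ROp RAdd 6 6 7) ;; Prim (IAdd 16 16 reg1)).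

Definition p_dist_row :=
  CFor 11 0 (Prim (ROp RSub 6 6 6) ;; p_dist_acc ;; Prim (RStore 2 14 6) ;;
    Prim (IAdd 14 14 reg1)).

Definition p_dist :=
  Prim (ISet 14 0) ;; Prim (ISet 15 0) ;;
  CFor 10 1 (Prim (ISet 16 0) ;; p_dist_row ;; Prim (IAdd 15 15 2)).

(** Adding register 29, which is 0, copies an integer register. *)
Definition p_min_row :=
  CFor 11 0 (Prim (RLoad 7 2 14) ;;
    CIte (RLt 7 6) (Prim (RLoad 6 2 14) ;; Prim (IAdd 18 11 29)) skip ;;
    Prim (IAdd 14 14 reg1)).

(** The minimal distances are stored twice: selection overwrites array 4, while array 3 is needed
    afterwards for the threshold test. Array 2 becomes the identity and register 9 becomes [n], so
    that the next [p_means] runs over all points. *)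
Definition p_mins :=
  Prim (ISet 14 0) ;; Prim (ISet 9 0) ;;
  CFor 10 1 (Prim (RLoad 6 2 14) ;; Prim (ISet 18 0) ;; p_min_row ;;
    Prim (RStore 3 10 6) ;; Prim (RStore 4 10 6) ;; Prim (IStore 1 10 18) ;;
    Prim (IStore 2 10 10) ;; Prim (IAdd 9 9 reg1)).

(** Label [k] marks an outlier. A point exactly at the threshold becomes one: the threshold aimed at
    is the least distance of an outlier. *)
Definition p_label :=
  CFor 10 1 (Prim (RLoad 6 3 10) ;; CIte (RLt 6 3) skip (Prim (IStore 1 10 0))).

Definition p_consts :=
  Prim (ROfI 7 0) ;; Prim (ROfI 8 1) ;; Prim (ROp RMul 9 1 8) ;;
  Prim (ROp RDiv 9 9 7) ;; Prim (ROp RMul 10 0 0) ;; Prim (ISet 20 1).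

Definition p_count :=
  CFor 11 1 (Prim (ILoad 18 1 11) ;; IfEq 18 10 (Prim (IAdd 19 19 reg1))).

Definition p_bal :=
  CFor 10 0 (Prim (ISet 19 0) ;; p_count ;; Prim (ROfI 6 19) ;;
    CIte (RLt 6 9) (Prim (ISet 20 0)) skip).

(** Besides the cost in real register 4 this leaves the number of outliers in register 21 and the
    largest squared distance of an inlier to its own mean in real register 5. *)
Definition p_cost :=
  Prim (ISet 14 0) ;; Prim (ISet 21 0) ;; Prim (ROp RSub 4 4 4) ;;
  Prim (ROp RSub 5 5 5) ;;
  CFor 10 1 (Prim (ILoad 18 1 10) ;;
    CIte (ILt 18 0)
      (Prim (IAdd 17 14 18) ;; Prim (RLoad 6 2 17) ;; Prim (ROp RAdd 4 4 6) ;;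
       CIte (RLt 5 6) (Prim (RLoad 5 2 17)) skip)
      (Prim (IAdd 21 21 reg1)) ;;
    Prim (IAdd 14 14 0)).

Definition p_prox_row :=
  CFor 11 0 (Prim (RLoad 7 2 14) ;;
    CIte (RLt 6 7) skip
      (CIte (ILt 11 18) (Prim (ISet 20 0))
        (CIte (ILt 18 11) (Prim (ISet 20 0)) skip)) ;;
    Prim (IAdd 14 14 reg1)).

(** Outliers are tested against the largest inlier distance only, so the check is linear in the
    table of distances instead of running over pairs of points. The label of an outlier is at least
    [k], hence its row skips no center. *)
Definition p_prox :=
  Prim (ROp RMul 5 10 5) ;; Prim (ISet 14 0) ;;
  CFor 10 1 (Prim (ILoad 18 1 10) ;;
    CIte (ILt 18 0)
      (Prim (IAdd 17 14 18) ;; Prim (RLoad 6 2 17) ;; Prim (ROp RMul 6 10 6))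
      (Prim (ROp RSub 7 7 7) ;; Prim (ROp RAdd 6 5 7)) ;;
    p_prox_row).

Definition p_accept :=
  Prim (ISet 7 1) ;; Prim (ROp RSub 6 6 6) ;; Prim (ROp RAdd 2 4 6) ;;
  CFor 10 1 (Prim (ILoad 18 1 10) ;; Prim (IStore 0 10 18)).

Definition p_update :=
  IfEq 21 3
    (CIte (ILt 29 20)
      (CIte (ILt 29 7) (CIte (RLt 4 2) p_accept skip) p_accept) skip).

Section Pieces.
Variable R : realType.
Implicit Types s : state R.

Lemma p_dist_accP s : (ireg s 4 = 1)%N -> let s' := run p_dist_acc s in
  ireg s' 16 = (ireg s 16 + ireg s 2)%N /\
  rreg s' 6 = rreg s 6 + \sum_(l < ireg s 2)
     (rarr s 0 (ireg s 15 + l)%N - rarr s 1 (ireg s 16 + l)%N) ^+ 2.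
Proof.
move=> e1.
pose I q s' := ireg s' 16 = (ireg s 16 + q)%N /\
  rreg s' 6 = rreg s 6 + \sum_(l < q)
     (rarr s 0 (ireg s 15 + l)%N - rarr s 1 (ireg s 16 + l)%N) ^+ 2.
suff : I (ireg s 2) (run p_dist_acc s) by [].
apply: for_ind; first by rewrite /I big_ord0 addn0 addr0.
move=> q s' qN e S [I1 I2]; rewrite !runE /I big_ord_recr /= e.
by rewrite I1 I2 !(sameI S) // e1 !(sameRA S) // addn1 addnS expr2 addrA.
Qed.

Lemma p_distP s i j : (ireg s 4 = 1)%N -> (i < ireg s 1)%N -> (j < ireg s 0)%N ->
  rarr (run p_dist s) 2 (i * ireg s 0 + j)%N = \sum_(l < ireg s 2)
     (rarr s 0 (i * ireg s 2 + l)%N - rarr s 1 (j * ireg s 2 + l)%N) ^+ 2.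
Proof.
move=> e1 iN jk; rewrite /p_dist !runS !runP; set s0 := step _ (step _ s).
pose V i j := \sum_(l < ireg s 2)
     (rarr s 0 (i * ireg s 2 + l)%N - rarr s 1 (j * ireg s 2 + l)%N) ^+ 2.
pose k := ireg s 0.
pose I i j s' := ireg s' 14 = (i * k + j)%N /\
  forall a b, (b < k)%N -> (a * k + b < i * k + j)%N -> rarr s' 2 (a * k + b)%N = V a b.
pose J i s' := I i 0%N s' /\ ireg s' 15 = (i * ireg s 2)%N.
suff [[_ H] _] : J (ireg s0 1) (run (CFor 10 1 (Prim (ISet 16 0) ;; p_dist_row ;; Prim (IAdd 15 15 2))) s0).
  by apply: H => //; rewrite addn0 /=; apply: mulnD_lt.
apply: (@for_ind _ J); first by split; first split.
move=> {iN jk} {}i s1 iN e S [[I1 I2] I3]; rewrite !runE.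
set s2 := step _ s1.
have : I i (ireg s2 0) (run p_dist_row s2) /\ ireg (run p_dist_row s2) 16 = (ireg s2 0 * ireg s 2)%N.
  apply: (@for_ind _ (fun p s' => I i p s' /\ ireg s' 16 = (p * ireg s 2)%N)).
    by split => //; split.
  move=> {}j s3; rewrite /= (sameI S) // => jk e3 S3 [[J1 J2] J3]; rewrite !runE.
  set s4 := step _ s3; have S4 := same_run p_dist_acc s4.
  have [|A1 A2] := @p_dist_accP s4; first by rewrite /= (sameI S3) //= (sameI S).
  rewrite /= subrr add0r J3 (sameI S3) //= (sameI S3) //= I3 (sameI S) //= (sameRA S3) // (sameRA S) //= (sameRA S3) // (sameRA S) //= in A1 A2.
  split; last by rewrite /= A1 mulSn addnC.
  rewrite /I /= !(sameI S4) //= J1 !(sameI S3) //= !(sameI S) //= e1 addn1 addnS; split => // a b bk ab.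
  case: eqP => [E|/eqP ne]; first by have [-> ->] := mulnD_inj bk jk E.
  by rewrite (sameRA S4) //=; apply: J2; rewrite //; move: ab ne; rewrite -/k; lia.
rewrite /= (sameI S) //; case=> [[K1 K2] K3].
have S2 := same_run p_dist_row s2.
split; last first.
  by rewrite /= (sameI S2) //= (sameI S2) //= I3 (sameI S) // mulSn addnC.
split; first by rewrite /= K1 -/k addn0 mulSn addnC.
by move=> a b bk; rewrite addn0 mulSn (addnC k); apply: K2.
Qed.

Lemma p_min_rowP s : (ireg s 4 = 1)%N -> (ireg s 29 = 0)%N -> (0 < ireg s 0)%N ->
  ireg s 18 = 0%N -> rreg s 6 = rarr s 2 (ireg s 14) -> let s' := run p_min_row s in
  [/\ (ireg s' 18 < ireg s 0)%N, rreg s' 6 = rarr s 2 (ireg s 14 + ireg s' 18)%N,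
      forall j, (j < ireg s 0)%N -> rreg s' 6 <= rarr s 2 (ireg s 14 + j)%N
    & ireg s' 14 = (ireg s 14 + ireg s 0)%N].
Proof.
move=> e1 e0 k0 l0 m0.
pose I p s' := [/\ (ireg s' 18 < ireg s 0)%N,
  rreg s' 6 = rarr s 2 (ireg s 14 + ireg s' 18)%N,
  forall j, (j < p)%N -> rreg s' 6 <= rarr s 2 (ireg s 14 + j)%N
  & ireg s' 14 = (ireg s 14 + p)%N].
suff : I (ireg s 0) (run p_min_row s) by [].
apply: for_ind; first by split; rewrite /= ?l0 ?addn0.
move=> p s' pk e S [I1 I2 I3 I4]; rewrite !runE /=.
have E1 : ireg s' 4 = 1%N by rewrite (sameI S).
have E0 : ireg s' 29 = 0%N by rewrite (sameI S).
rewrite I4 (sameRA S) //.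
case: ltP => h; split; rewrite /= ?e ?E1 ?E0 ?I4 ?addn0 ?addn1 ?addnS //.
- move=> j; rewrite ltnS leq_eqVlt => /orP[/eqP-> //|jp].
  exact: le_trans (ltW h) (I3 j jp).
- by move=> j; rewrite ltnS leq_eqVlt => /orP[/eqP-> //|jp]; apply: I3.
Qed.

Lemma p_minsP s : (ireg s 4 = 1)%N -> (ireg s 29 = 0)%N -> (0 < ireg s 0)%N ->
  let s' := run p_mins s in ireg s' 9 = ireg s 1 /\ forall i, (i < ireg s 1)%N ->
  [/\ (iarr s' 1 i < ireg s 0)%N,
      rarr s' 3 i = rarr s 2 (i * ireg s 0 + iarr s' 1 i)%N,
      forall j, (j < ireg s 0)%N -> rarr s' 3 i <= rarr s 2 (i * ireg s 0 + j)%N,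
      rarr s' 4 i = rarr s' 3 i & iarr s' 2 i = i].
Proof.
move=> e1 e0 k0; rewrite /p_mins !runS !runP; set s0 := step _ (step _ s).
set c := CFor _ _ _.
pose I p s' := [/\ ireg s' 9 = p, ireg s' 14 = (p * ireg s 0)%N
 & forall i, (i < p)%N ->
  [/\ (iarr s' 1 i < ireg s 0)%N,
      rarr s' 3 i = rarr s 2 (i * ireg s 0 + iarr s' 1 i)%N,
      forall j, (j < ireg s 0)%N -> rarr s' 3 i <= rarr s 2 (i * ireg s 0 + j)%N,
      rarr s' 4 i = rarr s' 3 i & iarr s' 2 i = i]].
suff [] : I (ireg s0 1) (run c s0) by [].
apply: (@for_ind _ I); first by split.
move=> p s1 pn e S [I1 I2 I3]; rewrite !runE.
set s2 := step _ (step _ s1).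
have [||||| A1 A2 A3 A4] := @p_min_rowP s2 => //=; rewrite ?(sameI S) //.
have S2 := same_run p_min_row s2.
rewrite /= (sameI S) //= in A1 A3 A4; rewrite /= I2 (sameRA S) //= in A2 A3 A4.
split.
- by rewrite /= (sameI S2) //= I1 (sameI S2) //= (sameI S) //= e1 addn1.
- by rewrite /= A4 mulSn addnC.
rewrite /= (sameI S2) //= e => i ip; case: eqP => [->|/eqP ne]; first by split.
rewrite !(sameRA S2) // !(sameIA S2) //=; apply: I3.
by move: ip ne; lia.
Qed.

Lemma p_labelP s i : (i < ireg s 1)%N ->
  iarr (run p_label s) 1 i =
  if rarr s 3 i < rreg s 3 then iarr s 1 i else ireg s 0.
Proof.
pose I p s' := forall i, iarr s' 1 i =
  if (p <= i)%N || (rarr s 3 i < rreg s 3) then iarr s 1 i else ireg s 0.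
suff : I (ireg s 1) (run p_label s).
  by move=> H iN; rewrite (H i) leqNgt iN.
apply: for_ind; first by move=> j; rewrite leq0n.
move=> p s' pn e S H; rewrite !runE /= (sameRA S) // (sameR S) // e.
case: ltP => h j /=.
  rewrite H; have [->|ne] := eqVneq j p; first by rewrite h !orbT.
  by rewrite [(p <= j)%N]leq_eqVlt eq_sym (negbTE ne).
case: eqP => [->|/eqP ne]; first by rewrite ltnn ltNge h (sameI S).
by rewrite H ltn_neqAle eq_sym ne.
Qed.

Lemma p_countP s : (ireg s 4 = 1)%N -> let s' := run p_count s in
  ireg s' 19 = (ireg s 19 + \sum_(i < ireg s 1) (iarr s 1 i == ireg s 10))%N.
Proof.
move=> e1; pose I p s' :=
  ireg s' 19 = (ireg s 19 + \sum_(i < p) (iarr s 1 i == ireg s 10))%N.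
suff : I (ireg s 1) (run p_count s) by [].
apply: for_ind; first by rewrite /I big_ord0 addn0.
move=> p s' pn e S H; rewrite !runE /I big_ord_recr /= e (sameIA S) // (sameI S) //.
by case: ifP => h /=; rewrite H ?(sameI S) ?e1 ?addn0 ?addnA.
Qed.

Lemma p_balP s : (ireg s 4 = 1)%N -> let s' := run p_bal s in
  (0 < ireg s' 20)%N <-> (0 < ireg s 20)%N /\ forall j, (j < ireg s 0)%N ->
    rreg s 9 <= (\sum_(i < ireg s 1) (iarr s 1 i == j))%:R.
Proof.
move=> e1; pose I p s' :=
  (0 < ireg s' 20)%N <-> (0 < ireg s 20)%N /\ forall j, (j < p)%N ->
    rreg s 9 <= (\sum_(i < ireg s 1) (iarr s 1 i == j))%:R.
suff : I (ireg s 0) (run p_bal s) by [].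
apply: for_ind; first by split=> // -[].
move=> p s1 pn e S H; rewrite !runE.
set s2 := step _ s1; have := @p_countP s2; have S2 := same_run p_count s2.
rewrite /= e !(sameI S) // (sameIA S) // => /(_ e1) ->.
rewrite add0n (sameR S2) //= (sameR S) //.
case: ltP => h; rewrite /I /=.
  split=> // -[_ /(_ p (leqnn _))]; rewrite leNgt h //.
rewrite (sameI S2) //=; apply: (iff_trans H); split=> -[H1 H2]; split=> // j jp.
  by have [->//|/eqP ne] := eqVneq j p; apply: H2; move: jp ne; lia.
by apply: H2; rewrite ltnS ltnW.
Qed.

End Pieces.

Section Pieces.
Variable R : realType.
Implicit Types s : state R.

(** A mere upper bound in register 5 could make the proximity test reject admissible labellings; the
    last clause says that the bound is attained or is 0. *)
Lemma p_costP s : (ireg s 4 = 1)%N -> let s' := run p_cost s in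
  let k := ireg s 0 in let A := iarr s 1 in let D := rarr s 2 in
  [/\ ireg s' 21 = (\sum_(i < ireg s 1) ~~ (A i < k))%N,
      rreg s' 4 = \sum_(i < ireg s 1 | (A i < k)%N) D (i * k + A i)%N,
      forall i, (i < ireg s 1)%N -> (A i < k)%N -> D (i * k + A i)%N <= rreg s' 5
    & rreg s' 5 = 0 \/ exists i, [/\ (i < ireg s 1)%N, (A i < k)%N
        & rreg s' 5 = D (i * k + A i)%N]].
Proof.
move=> e1 /=; rewrite /p_cost !runS !runP.
set s0 := step _ _; set c := CFor _ _ _; pose k := ireg s 0.
pose A := iarr s 1; pose D := rarr s 2.
pose I p s' := ireg s' 14 = (p * k)%N /\ [/\
  ireg s' 21 = (\sum_(i < p) ~~ (A i < k))%N,
  rreg s' 4 = \sum_(i < p) (if (A i < k)%N then D (i * k + A i)%N else 0),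
  forall i, (i < p)%N -> (A i < k)%N -> D (i * k + A i)%N <= rreg s' 5
  & rreg s' 5 = 0 \/ exists i, [/\ (i < ireg s 1)%N, (A i < k)%N
        & rreg s' 5 = D (i * k + A i)%N]].
suff [_ [I1 I2 I3 I4]] : I (ireg s0 1) (run c s0).
  by split => //; rewrite [RHS]big_mkcond.
apply: (@for_ind _ I).
  by split => //=; split; rewrite /= ?subrr ?big_ord0 //; left.
move=> p s' pn e S [I0 [I1 I2 I3 I4]]; rewrite !runE /= e.
have E1 : ireg s' 4 = 1%N by rewrite (sameI S).
have E0 : ireg s' 0 = k by rewrite (sameI S).
rewrite (sameIA S) // (sameRA S) // E0 -/A -/D I0.
have lt q : (q < p.+1)%N -> q = p \/ (q < p)%N.
  by rewrite ltnS leq_eqVlt => /orP[/eqP|]; [left|right].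
case Ap: (A p < k)%N.
  case: ltP => h; split; rewrite /= ?E0 ?I0 ?mulSn 1?[(k + _)%N]addnC //.
    split; rewrite /= ?big_ord_recr /= ?Ap ?addn0 ?I1 ?I2 //.
    - by move=> i /lt[-> //|ip] Ai; apply: le_trans (I3 i ip Ai) (ltW h).
    - by right; exists p.
  split; rewrite /= ?big_ord_recr /= ?Ap ?addn0 ?I1 ?I2 //.
  by move=> i /lt[-> //|ip] Ai; apply: I3.
split; rewrite /= ?E0 ?I0 ?mulSn 1?[(k + _)%N]addnC //.
split; rewrite /= ?big_ord_recr /= ?Ap ?addr0 ?E1 ?I1 ?I2 //.
by move=> i /lt[->|ip] Ai; [rewrite Ap in Ai|apply: I3].
Qed.

Lemma p_prox_rowP s : (ireg s 4 = 1)%N -> let s' := run p_prox_row s in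
  ireg s' 14 = (ireg s 14 + ireg s 0)%N /\
  ((0 < ireg s' 20)%N <-> (0 < ireg s 20)%N /\ forall j, (j < ireg s 0)%N ->
    j != ireg s 18 -> rreg s 6 < rarr s 2 (ireg s 14 + j)%N).
Proof.
move=> e1; pose I p s' := ireg s' 14 = (ireg s 14 + p)%N /\
  ((0 < ireg s' 20)%N <-> (0 < ireg s 20)%N /\ forall j, (j < p)%N ->
    j != ireg s 18 -> rreg s 6 < rarr s 2 (ireg s 14 + j)%N).
suff : I (ireg s 0) (run p_prox_row s) by [].
apply: for_ind; first by split; rewrite /= ?addn0 //; split=> // -[].
move=> p s' pn e S [I1 I2]; rewrite !runE /= e.
have E1 : ireg s' 4 = 1%N by rewrite (sameI S).
have E18 : ireg s' 18 = ireg s 18 by rewrite (sameI S).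
have E6 : rreg s' 6 = rreg s 6 by rewrite (sameR S).
rewrite E18 E6 (sameRA S) // I1.
have lt q : (q < p.+1)%N -> q = p \/ (q < p)%N.
  by rewrite ltnS leq_eqVlt => /orP[/eqP|]; [left|right].
case: ltP => h.
  split; rewrite /= ?I1 ?E1 ?addn1 ?addnS //.
  apply: (iff_trans I2); split=> -[H1 H2]; split=> // j.
    by move=> /lt[->//|]; apply: H2.
  by move=> jp; apply: H2; rewrite ltnW.
have fail : p != ireg s 18 -> ~ ((0 < ireg s 20)%N /\ forall j, (j < p.+1)%N ->
    j != ireg s 18 -> rreg s 6 < rarr s 2 (ireg s 14 + j)%N).
  by move=> np [_ /(_ p (leqnn _) np)]; rewrite ltNge h.
case: (ltngtP p (ireg s 18)) => cmp; split; rewrite /= ?I1 ?E1 ?addn1 ?addnS //.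
- by split=> // H; case: (fail _ H); rewrite neq_ltn cmp.
- by split=> // H; case: (fail _ H); rewrite neq_ltn cmp orbT.
- apply: (iff_trans I2); split=> -[H1 H2]; split=> // j.
    by move=> /lt[->|]; [rewrite cmp eqxx|apply: H2].
  by move=> jp; apply: H2; rewrite ltnW.
Qed.

Lemma p_proxP s : (ireg s 4 = 1)%N -> let s' := run p_prox s in
  let k := ireg s 0 in let A := iarr s 1 in let D := rarr s 2 in
  (0 < ireg s' 20)%N <-> (0 < ireg s 20)%N /\
    forall i j, (i < ireg s 1)%N -> (j < k)%N -> j != A i ->
    rreg s 10 * (if (A i < k)%N then D (i * k + A i)%N else rreg s 5) <
    D (i * k + j)%N.
Proof.
move=> e1 /=; rewrite /p_prox !runS !runP.
set s0 := step _ _; set c := CFor _ _ _; pose k := ireg s 0.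
pose A := iarr s 1; pose D := rarr s 2.
pose I p s' := ireg s' 14 = (p * k)%N /\
  ((0 < ireg s' 20)%N <-> (0 < ireg s 20)%N /\
    forall i j, (i < p)%N -> (j < k)%N -> j != A i ->
    rreg s 10 * (if (A i < k)%N then D (i * k + A i)%N else rreg s 5) <
    D (i * k + j)%N).
suff [_ H] : I (ireg s0 1) (run c s0) by [].
apply: (@for_ind _ I); first by split => //=; split=> // -[].
move=> p s1 pn e S [I1 I2]; rewrite !runS.
set s2 := run (CIte _ _ _) _.
have [E2 E6 E18] : [/\ same (CFor 10 1 (Prim (ILoad 18 1 10) ;; CIte (ILt 18 0)
      (Prim (IAdd 17 14 18) ;; Prim (RLoad 6 2 17) ;; Prim (ROp RMul 6 10 6))
      (Prim (ROp RSub 7 7 7) ;; Prim (ROp RAdd 6 5 7)))) s1 s2,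
    rreg s2 6 = rreg s 10 * (if (A p < k)%N then D (p * k + A p)%N else rreg s 5)
    & ireg s2 18 = A p].
  split.
  - split=> x; rewrite /s2 !runE /=.
    + by rewrite !inE !negb_or => /and3P[/negbTE n10 /negbTE n18 /negbTE n17]; case: ifP => _ /=; rewrite ?n18 ?n17.
    + by rewrite !inE !negb_or => /and4P[/negbTE n6 _ /negbTE n7 _]; case: ifP => _ /=; rewrite ?n6 ?n7.
    + by case: ifP.
    + by case: ifP.
  - rewrite /s2 !runE /= e (sameIA S) // (sameI S) // -/A -/k I1.
    case: ifP => Ap /=; first by rewrite (sameRA S) // (sameR S).
    by rewrite (sameR S) //= subrr addr0.
  - by rewrite /s2 !runE /= e (sameIA S) // (sameI S) // -/A -/k; case: ifP.
have e14 : ireg s2 14 = (p * k)%N by rewrite (sameI E2).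
have e0 : ireg s2 0 = k by rewrite (sameI E2) // (sameI S).
have e20 : ireg s2 20 = ireg s1 20 by rewrite (sameI E2).
have eD : rarr s2 2 = D by rewrite (sameRA E2) // (sameRA S).
have [|A1 A2] := @p_prox_rowP s2; first by rewrite (sameI E2) // (sameI S).
rewrite e14 e0 e20 eD E18 E6 in A1 A2.
split; first by rewrite /= A1 mulSn addnC.
apply: (iff_trans A2); split=> [[/I2[H1 H2] H3]|[H1 H2]].
  split=> // i j ip jk ji; have [ei|/eqP ne] := eqVneq i p.
    by rewrite ei; apply: H3 => //; rewrite -ei.
  by apply: H2 => //; move: ip ne; lia.
split; first by apply/I2; split=> // i j ip; apply: H2; rewrite ltnW.
by move=> j; apply: H2.
Qed.

Lemma p_acceptP s : let s' := run p_accept s in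
  [/\ ireg s' 7 = 1%N, rreg s' 2 = rreg s 4
    & forall i, (i < ireg s 1)%N -> iarr s' 0 i = iarr s 1 i].
Proof.
rewrite /p_accept /= !runS !runP; set s0 := step _ _; set c := CFor _ _ _.
have S0 := same_run c s0.
split.
- by rewrite (sameI S0).
- by rewrite (sameR S0) //= subrr addr0.
- pose I p s' := forall i, (i < p)%N -> iarr s' 0 i = iarr s 1 i.
  suff : I (ireg s0 1) (run c s0) by [].
  apply: (@for_ind _ I) => // p s' pn e S H; rewrite !runE => i /=.
  rewrite e (sameIA S) //; case: eqP => [->//|/eqP ne] ip; apply: H.
  by move: ip ne; lia.
Qed.

Lemma p_updateP s : ireg s 29 = 0%N -> let s' := run p_update s in
  if [&& ireg s 21 == ireg s 3, (0 < ireg s 20)%N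
       & (0 < ireg s 7)%N ==> (rreg s 4 < rreg s 2)]
  then [/\ ireg s' 7 = 1%N, rreg s' 2 = rreg s 4
         & forall i, (i < ireg s 1)%N -> iarr s' 0 i = iarr s 1 i]
  else [/\ ireg s' 7 = ireg s 7, rreg s' 2 = rreg s 2 & iarr s' 0 = iarr s 0].
Proof.
move=> e0; rewrite /p_update runEq !runI /eval_test e0.
have acc := p_acceptP s.
by case: eqP => //= _; case: ltnP => //= _; case: ltnP => //= _; case: ltP.
Qed.

End Pieces.

(** * Quickselect: one pass and its potential *)

Definition p_partition :=
  CFor 10 30 (Prim (RLoad 6 4 10) ;;
    CIte (RLt 3 6) (Prim (RStore 5 25 6) ;; Prim (IAdd 25 25 reg1))
      (CIte (RLt 6 3) (Prim (RStore 6 26 6) ;; Prim (IAdd 26 26 reg1)) skip)).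

Definition p_copy a r :=
  CFor 10 30 (Prim (RLoad 6 a 10) ;; Prim (RStore 4 10 6)) ;;
  Prim (IAdd 22 r 29).

(** Register 23 is the wanted rank [zz], counted from the largest of the [S] values. With [g] values
    above and [l] below the pivot, ranks [g + 1] to [S - l] belong to the pivot itself; in that case
    the budget in register 24 is set to 0, which ends the loop with the answer in real register
    3. *)
Definition p_split :=
  Prim (RLoad 3 4 27) ;; Prim (ISub 24 24 30) ;; Prim (ISet 25 0) ;;
  Prim (ISet 26 0) ;; p_partition ;;
  CIte (ILt 25 23)
    (Prim (ISub 17 30 26) ;;
     CIte (ILt 17 23) (Prim (ISub 23 23 17) ;; p_copy 6 26) (Prim (ISet 24 0)))
    (p_copy 5 25).

Definition sel_body : prog :=
  Seq (Draw 27 22) (Seq (IAdd 30 22 29) (compile p_split)).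

(** Three doublings make the budget [8 * n]. The loop test is strict: paying for a pass leaves at
    least 1, so a budget of 0 after a pass means that the answer was found. *)
Definition p_select : prog :=
  Seq (IAdd 22 1 29) (Seq (IAdd 23 3 29) (Seq (IAdd 24 1 1)
    (Seq (IAdd 24 24 24) (Seq (IAdd 24 24 24) (While (ILt 22 24) sel_body))))).

(* Only a list of the registers and arrays that selection writes. *)
Definition sel_frame :=
  Prim (ISet 27 0) ;; Prim (ISet 30 0) ;; Prim (ISet 22 0) ;;
  Prim (ISet 23 0) ;; Prim (ISet 24 0) ;; p_split.

Section Select.
Variable R : realType.
Implicit Types (s : state R) (w : seq R).

Lemma mkseq_upd (f g : nat -> R) q :
  (forall i, (i < q)%N -> f i = g i) -> mkseq f q = mkseq g q.
Proof.
by move=> fg; apply/eq_in_map => i; rewrite mem_iota add0n => /fg.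
Qed.

Lemma p_partitionP s : (ireg s 4 = 1)%N -> ireg s 25 = 0%N -> ireg s 26 = 0%N ->
  let s' := run p_partition s in let w := mkseq (rarr s 4) (ireg s 30) in
  mkseq (rarr s' 5) (ireg s' 25) = [seq u <- w | rreg s 3 < u] /\
  mkseq (rarr s' 6) (ireg s' 26) = [seq u <- w | u < rreg s 3].
Proof.
move=> e1 e25 e26; pose I p s' :=
  mkseq (rarr s' 5) (ireg s' 25) = [seq u <- mkseq (rarr s 4) p | rreg s 3 < u] /\
  mkseq (rarr s' 6) (ireg s' 26) = [seq u <- mkseq (rarr s 4) p | u < rreg s 3].
suff : I (ireg s 30) (run p_partition s) by [].
apply: for_ind; first by rewrite /I /= e25 e26.
move=> p s' pn e S [I1 I2]; rewrite !runE /= e.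
have E1 : ireg s' 4 = 1%N by rewrite (sameI S).
rewrite (sameRA S) // (sameR S) // /I !mkseqS !filter_rcons.
case: ltgtP => h; rewrite /= ?E1 ?addn1 ?mkseqS /= ?eqxx; split=> //.
- by rewrite -I1; congr rcons; apply: mkseq_upd => i iq /=; rewrite ltn_eqF.
- by rewrite -I2; congr rcons; apply: mkseq_upd => i iq /=; rewrite ltn_eqF.
Qed.

Lemma p_copyP a r s : a != 4%N -> (ireg s 29 = 0)%N -> r != 10%N ->
  (ireg s r <= ireg s 30)%N -> let s' := run (p_copy a r) s in
  ireg s' 22 = ireg s r /\
  mkseq (rarr s' 4) (ireg s' 22) = mkseq (rarr s a) (ireg s r).
Proof.
move=> a4 e0 r10 le; rewrite /p_copy runS; set c := CFor _ _ _.
have S0 := same_run c s.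
have H : forall i, (i < ireg s 30)%N -> rarr (run c s) 4 i = rarr s a i.
  pose I p s' := forall i, (i < p)%N -> rarr s' 4 i = rarr s a i.
  apply: (@for_ind _ I) => // p s' pn e S H; rewrite !runE => i /=.
  rewrite e (sameRA S); last by rewrite /= inE.
  by case: eqP => [->//|/eqP ne] ip; apply: H; move: ip ne; lia.
have -> : ireg (run (Prim (IAdd 22 r 29)) (run c s)) 22 = ireg s r.
  rewrite runP /= (sameI S0) ?(sameI S0) // ?e0 ?addn0 //.
  by rewrite /= inE.
by split=> //; apply: mkseq_upd => i ir; rewrite runP /= H // (leq_trans ir).
Qed.

Lemma p_splitP s : (ireg s 4 = 1)%N -> (ireg s 29 = 0)%N ->
  let s' := run p_split s in let w := mkseq (rarr s 4) (ireg s 30) in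
  let v := rarr s 4 (ireg s 27) in let zz := ireg s 23 in
  let g := count (fun u => v < u) w in let l := count (fun u => u < v) w in
  let w' := mkseq (rarr s' 4) (ireg s' 22) in
  rreg s' 3 = v /\
  if (zz <= g)%N then
    [/\ w' = [seq u <- w | v < u], ireg s' 23 = zz
      & ireg s' 24 = (ireg s 24 - ireg s 30)%N]
  else if (ireg s 30 - l < zz)%N then
    [/\ w' = [seq u <- w | u < v], ireg s' 23 = (zz - (ireg s 30 - l))%N
      & ireg s' 24 = (ireg s 24 - ireg s 30)%N]
  else ireg s' 24 = 0%N.
Proof.
move=> e1 e0 /=; rewrite /p_split !runS !runP.
set s0 := step _ (step _ (step _ (step _ s))).
have [|||P1 P2] := @p_partitionP s0 => //.
set s1 := run p_partition s0 in P1 P2 *.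
have S1 := same_run p_partition s0; rewrite -/s1 in S1.
rewrite /= in P1 P2.
have g1 : ireg s1 25 = count (fun u => rarr s 4 (ireg s 27) < u) (mkseq (rarr s 4) (ireg s 30)).
  by rewrite -size_filter -P1 size_mkseq.
have l1 : ireg s1 26 = count (fun u => u < rarr s 4 (ireg s 27)) (mkseq (rarr s 4) (ireg s 30)).
  by rewrite -size_filter -P2 size_mkseq.
have g30 : (ireg s1 25 <= ireg s1 30)%N.
  by rewrite g1 (sameI S1) //= (leq_trans (count_size _ _)) // size_mkseq.
have l30 : (ireg s1 26 <= ireg s1 30)%N.
  by rewrite l1 (sameI S1) //= (leq_trans (count_size _ _)) // size_mkseq.
have z1 : ireg s1 29 = 0%N by rewrite (sameI S1).
have t1 : rreg s1 3 = rarr s 4 (ireg s 27) by rewrite (sameR S1).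
have E24 : ireg s1 24 = (ireg s 24 - ireg s 30)%N by rewrite (sameI S1).
have E23 : ireg s1 23 = ireg s 23 by rewrite (sameI S1).
have E30 : ireg s1 30 = ireg s 30 by rewrite (sameI S1).
rewrite runI /eval_test E23 g1 [(_ <= count _ _)%N]leqNgt; case: ifP => _; rewrite [~~ _]/=.
  rewrite runS runI runP /= E30 E23 l1; case: ifP => _; last by rewrite runP /= t1.
  rewrite runS runP; set s2 := step _ _.
  have S2 := same_run (p_copy 6 26) s2.
  have [C1 C2] := @p_copyP 6 26 s2 isT z1 isT l30.
  by rewrite C2 (sameR S2) // !(sameI S2) //= P2 E24; split => //; split => //; rewrite E23.
have S2 := same_run (p_copy 5 25) s1.
have [C1 C2] := @p_copyP 5 25 s1 isT z1 isT g30.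
by rewrite C2 (sameR S2) // !(sameI S2) // P1; split.
Qed.

(** The length of the list that survives a pass with pivot [v] when [t] is sought. *)
Definition kept (t : R) w (v : R) : nat :=
  if v < t then count (fun u => v < u) w
  else if t < v then count (fun u => u < v) w else 0%N.

(** Counting ordered pairs (pivot, survivor): of the two orders of a pair at most one counts, unless
    [t] lies strictly between the two values. With [L] values below and [G] above [t], twice the sum
    is at most [size w ^ 2 + 2 * L * G], and [4 * L * G <= size w ^ 2]. *)
Lemma sum_kept t w : (4 * \sum_(v <- w) kept t w v <= 3 * size w ^ 2)%N.
Proof.
pose a (v u : R) := (((v < t)%R && (v < u)%R) + ((t < v)%R && (u < v)%R))%N.
have kE v : kept t w v = (\sum_(u <- w) a v u)%N.
  rewrite /a big_split /= /kept; case: ltgtP => h /=.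
  - by rewrite [X in (_ + X)%N]big1 // addn0 -sum1_count big_mkcond.
  - by rewrite [X in (X + _)%N]big1 // add0n -sum1_count big_mkcond.
  - by rewrite !big1.
have sw (b : R -> R -> nat) : (\sum_(v <- w) \sum_(u <- w) b v u =
    \sum_(v <- w) \sum_(u <- w) b u v)%N by rewrite exchange_big.
pose L := count (fun u => u < t) w; pose G := count (fun u => t < u) w.
have LG : (L + G <= size w)%N.
  rewrite /L /G -!sum1_count -[size w]sum1_size big_mkcond [X in (_ + X)%N]big_mkcond /=.
  by rewrite -big_split /=; apply: leq_sum => u _; case: ltgtP.
have LGs : (\sum_(v <- w) \sum_(u <- w) ((v < t)%R && (t < u)%R) = L * G)%N.
  rewrite /L /G -!sum1_count big_distrl /= [RHS]big_mkcond /=.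
  apply: eq_bigr => v _; rewrite mul1n; case: ifP => _ /=; last by rewrite big1.
  by rewrite [RHS]big_mkcond; apply: eq_bigr => u _; case: ifP.
have two : (2 * \sum_(v <- w) kept t w v <= size w * size w + 2 * (L * G))%N.
  have -> : (2 * \sum_(v <- w) kept t w v =
      \sum_(v <- w) \sum_(u <- w) (a v u + a u v))%N.
    under [RHS]eq_bigr do rewrite big_split /=.
    rewrite big_split /= -[X in (_ + X)%N]sw addnn -mul2n; congr (_ * _)%N.
    exact: eq_bigr.
  have -> : (size w * size w + 2 * (L * G) = \sum_(v <- w) \sum_(u <- w)
     (1 + (((v < t)%R && (t < u)%R) + ((u < t)%R && (t < v)%R))))%N.
    under [RHS]eq_bigr do rewrite !big_split /=.
    rewrite !big_split /= -[X in (_ + (_ + X))%N]sw LGs addnn mul2n; congr (_ + _)%N.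
    by rewrite sum1_size big_const_seq count_predT iter_addn_0.
  apply: leq_sum => v _; apply: leq_sum => u _; rewrite /a.
  by case: (ltgtP v u) => h1; case: (ltgtP v t) => h2; case: (ltgtP u t) => h3;
    rewrite //= ?(lt_asym, ltxx) //; lra.
have LG2 : (4 * (L * G) <= size w * size w)%N.
  apply: leq_trans (leq_mul LG LG).
  by have [/subnK <-|/ltnW/subnK <-] := leqP L G; nia.
rewrite -mulnn; lia.
Qed.


(** The rank being in range keeps the list nonempty, so that no draw aborts; this part serves
    termination. That [t] has this rank is demanded only for [b != 0]. *)
Definition sel_inv (t b : R) s : Prop :=
  (0 < ireg s 24)%N -> let w := mkseq (rarr s 4) (ireg s 22) in
  (0 < ireg s 23 <= ireg s 22)%N /\ (b != 0 ->
    (count (fun u => t < u)%R w < ireg s 23 <= count (fun u => t <= u)%R w)%N).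

(* A lower bound on the probability of ending with the threshold t: the budget
   in register 24 pays for the array lengths, which shrink by 3/4 on average. *)
Definition sel_pot (t : R) s : R :=
  if ireg s 24 == 0%N then (rreg s 3 == t)%:R
  else Num.max 0 (1 - 4 * (ireg s 22)%:R / (ireg s 24)%:R).

Lemma sel_pot_ge0 t s : 0 <= sel_pot t s.
Proof. by rewrite /sel_pot; case: ifP => _; rewrite ?ler0n // le_max lexx. Qed.

Lemma count_leC (v : R) w :
  (count (fun u => (v <= u)%R) w = size w - count (fun u => (u < v)%R) w)%N.
Proof.
rewrite -(count_predC (fun u => (u < v)%R) w) addKn.
by apply: eq_count => u /=; rewrite leNgt.
Qed.

Lemma sel_step (t b : R) s m (s' := run p_split (set_ireg (set_ireg s 27 m) 30 (ireg s 22)))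
    (w := mkseq (rarr s 4) (ireg s 22)) :
  ireg s 4 = 1%N -> ireg s 29 = 0%N -> (ireg s 22 < ireg s 24)%N -> sel_inv t b s ->
  [/\ (ireg s' 24 <= ireg s 24 - ireg s 22)%N, sel_inv t b s'
    & b != 0 -> 1 - 4 * (kept t w (rarr s 4 m))%:R / (ireg s 24 - ireg s 22)%:R
        <= sel_pot t s'].
Proof.
move=> e1 e0 lt inv.
have [/andP[z0 zS] tz] := inv (leq_ltn_trans (leq0n _) lt).
have [|t3] := @p_splitP (set_ireg (set_ireg s 27 m) 30 (ireg s 22)) e1; first by [].
rewrite -/s' /= -/w; set v := rarr s 4 m in t3 *.
set g := count (fun u => v < u) w; set l := count (fun u => u < v) w.
have sw : size w = ireg s 22 by rewrite size_mkseq.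
have gel : (count (fun u => (v <= u)%R) w = ireg s 22 - l)%N by rewrite count_leC sw.
have D0 : 0 < (ireg s 24 - ireg s 22)%:R :> R by rewrite ltr0n subn_gt0.
rewrite -/w in tz.
have [zg|gz] := leqP (ireg s 23) g.
  case=> W' Z' B'.
  have S' : ireg s' 22 = g by rewrite -(size_mkseq (rarr s' 4) (ireg s' 22)) W' size_filter.
  (* If [t <= v], the [zz] or more values above [v] would all lie above [t], against the rank of
     [t]. *)
  have vt : b != 0 -> v < t.
    move=> /tz /andP[tz1 tz2]; rewrite ltNge; apply: contraTN tz1 => tv.
    rewrite -leqNgt (leq_trans zg) //.
    by apply: sub_count => u /=; apply: le_lt_trans.
  split; first by rewrite B'.
  - move=> _ /=; rewrite W' Z' S'; split; first by rewrite z0.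
    move=> b0; have vt' := vt b0; rewrite !count_filter.
    have -> : count (predI (fun u => t < u) (fun u => v < u)) w = count (fun u => t < u) w.
      by apply: eq_count => u /=; apply: andb_idr; apply: lt_trans.
    have -> : count (predI (fun u => t <= u) (fun u => v < u)) w = count (fun u => t <= u) w.
      by apply: eq_count => u /=; apply: andb_idr; apply: lt_le_trans.
    exact: tz.
  - move=> /vt vt'; rewrite /sel_pot /kept vt' B' S' -/g.
    by rewrite (gtn_eqF (_ : 0 < _)%N) ?subn_gt0 // le_max lexx orbT.
have [lz|zl] := ltnP (ireg s 22 - l) (ireg s 23).
  case=> W' Z' B'.
  have S' : ireg s' 22 = l by rewrite -(size_mkseq (rarr s' 4) (ireg s' 22)) W' size_filter.
  have ls : (l <= ireg s 22)%N by rewrite -sw count_size.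
  have vt : b != 0 -> t < v.
    move=> /tz /andP[tz1 tz2]; rewrite ltNge; apply: contraTN tz2 => tv.
    rewrite -ltnNge (leq_ltn_trans _ lz) // -gel.
    by apply: sub_count => u /=; apply: le_trans.
  split; first by rewrite B'.
  - move=> _ /=; rewrite W' Z' S'; split; first by lia.
    move=> b0; have vt' := vt b0; rewrite !count_filter.
    (* The discarded values, all at least [v], are counted by both rank bounds, so both drop by
       exactly the amount subtracted from the rank. *)
    have spl (P : pred R) : (forall u, v <= u -> P u) ->
        (count P w = count (predI P (fun u => (u < v)%R)) w + (ireg s 22 - l))%N.
      move=> Pv; rewrite -gel -[LHS](size_filter P) -(count_predC (fun u => (u < v)%R)).
      rewrite !count_filter; congr (_ + _)%N; apply: eq_count => u /=.
        by rewrite andbC.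
      by rewrite -leNgt; apply: andb_idr => /Pv.
    have := tz b0; rewrite (spl (fun u => t < u)); last by move=> u; apply: lt_le_trans.
    rewrite (spl (fun u => t <= u)); first by move: lz; lia.
    by move=> u vu; apply: ltW; apply: lt_le_trans vu.
  - move=> /vt vt'; rewrite /sel_pot /kept vt' (lt_gtF vt') B' S' -/l.
    by rewrite (gtn_eqF (_ : 0 < _)%N) ?subn_gt0 // le_max lexx orbT.
move=> B'; rewrite /sel_inv /sel_pot B' eqxx; split=> // /tz /andP[tz1 tz2].
have vt : v = t.
  apply: le_anti; apply/andP; split; rewrite leNgt.
    apply: contraTN tz1 => tv; rewrite -leqNgt (leq_trans zl) // -gel.
    by apply: sub_count => u /=; apply: lt_le_trans.
  apply: contraTN tz2 => vt; rewrite -ltnNge (leq_ltn_trans _ gz) //.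
  by apply: sub_count => u /=; apply: lt_le_trans.
by rewrite (t3 : rreg s' 3 = v) vt /kept ltxx mulr0 mul0r subr0 eqxx.
Qed.

(** With length [S] and budget [B] the average of [kept] is at most [3 * S / 4], so the claim is
    [3 * S / (B - S) <= 4 * S / B], which holds exactly for [4 * S <= B]. Otherwise the potential is
    0. *)
Lemma sel_pot_step (t : R) s : (ireg s 22 < ireg s 24)%N -> (0 < ireg s 22)%N ->
  let w := mkseq (rarr s 4) (ireg s 22) in
  forall F : 'I_(ireg s 22) -> R, (forall m, 0 <= F m) ->
  (forall m : 'I_(ireg s 22), 1 - 4 * (kept t w (rarr s 4 m))%:R
     / (ireg s 24 - ireg s 22)%:R <= F m) ->
  sel_pot t s <= (\sum_m F m) / (ireg s 22)%:R.
Proof.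
move=> lt S0 w F F0 FP.
have b0 : (0 < ireg s 24)%N by apply: ltn_trans lt.
have Sr : 0 < (ireg s 22)%:R :> R by rewrite ltr0n.
have Br : 0 < (ireg s 24)%:R :> R by rewrite ltr0n.
rewrite /sel_pot gtn_eqF // ge_max divr_ge0 ?sumr_ge0 ?ler0n //=.
rewrite ler_pdivlMr //.
have [B4|B4] := ltP (ireg s 24)%:R (4 * (ireg s 22)%:R : R).
  apply: le_trans (_ : 0 <= _); last exact: sumr_ge0.
  rewrite mulr_le0_ge0 ?ler0n // subr_le0 ler_pdivlMr // mul1r ltW //.
have D : (ireg s 24 - ireg s 22)%:R = (ireg s 24)%:R - (ireg s 22)%:R :> R.
  by rewrite natrB // ltnW.
have D0 : 0 < (ireg s 24)%:R - (ireg s 22)%:R :> R by rewrite -D ltr0n subn_gt0.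
apply: le_trans (ler_sum _ (fun m _ => FP m)).
rewrite sumrB sumr_const card_ord -mulr_suml -mulr_sumr -natr_sum D.
have -> : (\sum_(m < ireg s 22) kept t w (rarr s 4 m) = \sum_(v <- w) kept t w v)%N.
  by rewrite big_map -(big_mkord xpredT (fun m => kept t w (rarr s 4 m))) /index_iota subn0.
have := sum_kept t w; rewrite size_mkseq -mulnn -(ler_nat R) !natrM.
set S := (ireg s 22)%:R in Sr B4 D0 *.
set B := (ireg s 24)%:R in Br B4 D0 * => k4.
rewrite mulrBl mul1r lerB // ler_pdivrMr //.
have -> : 4 * S / B * S * (B - S) = 4 * S * S * (B - S) / B by ring.
rewrite ler_pdivlMr //.
nra.
Qed.

End Select.

(** * Quickselect: the randomized loop *)

Section Random.
Variable R : realType.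
Implicit Types (s : state R).

Lemma same_trans c s1 s2 s3 : same c s1 s2 -> same c s2 s3 -> same c s1 s3.
Proof.
by move=> [A1 A2 A3 A4] [B1 B2 B3 B4]; split=> x xc;
  [rewrite B1 ?A1|rewrite B2 ?A2|rewrite B3 ?A3|rewrite B4 ?A4].
Qed.

Definition sub_mods c c' : bool :=
  [&& all (mem (imods c')) (imods c), all (mem (rmods c')) (rmods c),
      all (mem (iamods c')) (iamods c) & all (mem (ramods c')) (ramods c)].

Lemma same_sub c c' s s' : sub_mods c c' -> same c s s' -> same c' s s'.
Proof.
move=> /and4P[/allP h1 /allP h2 /allP h3 /allP h4] [A1 A2 A3 A4].
by split=> x xc; [apply: A1|apply: A2|apply: A3|apply: A4]; apply: contraNN xc;
  [apply: h1|apply: h2|apply: h3|apply: h4].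
Qed.

Lemma exec_self L c (E : state R -> Prop) t K s T :
  wf L c -> reg1 \in L -> ireg s reg1 = 1%N -> (btime (ireg s) c <= T)%N ->
  halts_with E t K (run c s) <= halts_with E (T + t) (compile c :: K) s.
Proof.
move=> w l1 s1 le; apply: le_trans (halts_mono _ _ _ (leq_add le (leqnn t))).
exact: (@exec R L (ireg s)).
Qed.

Lemma btime_split rho : (0 < rho 30)%N -> (btime rho p_split <= 60 * rho 30)%N.
Proof. by rewrite /btime /=; nia. Qed.

(** Strong induction on the budget [B]. A pass over a list of length [m] takes at most
    [60 * m + 5 <= 65 * m] steps and lowers the budget by at least [m >= 1], whence 65 steps per
    unit of budget. *)
Lemma select_loop (t a b : R) E K tt s0 : 0 <= b ->
  ireg s0 4 = 1%N -> ireg s0 29 = 0%N ->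
  (forall s', same sel_frame s0 s' ->
     a + b * (rreg s' 3 == t)%:R <= halts_with E tt K s') ->
  forall B s, ireg s 24 = B -> same sel_frame s0 s -> sel_inv t b s ->
  a + b * sel_pot t s <=
  halts_with E (65 * B + 1 + tt) (While (ILt 22 24) sel_body :: K) s.
Proof.
move=> b0 e1 e0 post; elim/ltn_ind => B IH s eB S inv.
(* On exit the potential promises nothing beyond the truth: either the budget is 0 and the potential
   is the indicator itself, or [1 - 4 * S / B] is negative. *)
have exit B' : (ireg s 24 <= ireg s 22)%N ->
    a + b * sel_pot t s <= halts_with E (B' + 1 + tt) (While (ILt 22 24) sel_body :: K) s.
  move=> le; rewrite addnAC addn1 halts_while /eval_test ltnNge le /=.
  apply: le_trans (halts_mono _ _ _ (leq_addl _ _)).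
  apply: le_trans (post _ S); rewrite lerD2l ler_wpM2l // /sel_pot.
  case: eqP => // /eqP; rewrite -lt0n => b24.
  rewrite ge_max ler0n /=; apply: le_trans (_ : 0 <= _); last exact: ler0n.
  rewrite subr_le0 ler_pdivlMr ?ltr0n // mul1r -natrM ler_nat.
  by rewrite (leq_trans le) // leq_pmull.
have [|lt] := leqP (ireg s 24) (ireg s 22); first exact: exit.
have [/andP[z0 zS] _] := inv (leq_ltn_trans (leq0n _) lt).
have S0 : (0 < ireg s 22)%N by apply: leq_trans zS.
have -> : (65 * B + 1 + tt = (65 * B - 4 + 1 + tt).+4)%N by lia.
rewrite halts_while /eval_test lt halts_seq halts_draw.
set m := ireg s 22.
have b1 : ireg s 4 = 1%N by rewrite (sameI S).
have b29 : ireg s 29 = 0%N by rewrite (sameI S).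
pose sm i := run p_split (set_ireg (set_ireg s 27 i) 30 (ireg s 22)).
have main (i : 'I_m) : a + b * sel_pot t (sm i) <=
    halts_with E (65 * B - 4 + 1 + tt).+1
      [:: Seq (IAdd 30 22 29) (compile p_split), While (ILt 22 24) sel_body & K]
      (set_ireg s 27 i).
  have [h1 h2 _] := sel_step i b1 b29 lt inv; rewrite -/(sm i) in h1 h2.
  rewrite halts_seq.
  have -> : (65 * B - 4 + 1 + tt = (60 * m + (65 * (B - m) + 1 + tt + (5 * m - 5))).+1)%N.
    by rewrite -eB; move: lt; rewrite -/m; lia.
  rewrite halts_prim //; set s1 := step _ _.
  have -> : s1 = set_ireg (set_ireg s 27 i) 30 (ireg s 22).
    by rewrite /s1 /= b29 addn0.
  have := @exec_self [:: 4; 29; 30]%N p_split E (65 * (B - m) + 1 + tt + (5 * m - 5))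
     (While (ILt 22 24) sel_body :: K) (set_ireg (set_ireg s 27 i) 30 (ireg s 22)) (60 * m).
  move/(_ isT isT b1 (btime_split _)) => /(_ S0); apply: le_trans.
  rewrite -/(sm i).
  apply: le_trans (halts_mono _ _ _ (leq_addr _ _)).
  apply: le_trans (halts_mono _ _ _ (_ : 65 * ireg (sm i) 24 + 1 + tt <= _)%N); last first.
    by rewrite !leq_add2r leq_mul2l; move: h1; rewrite eB.
  apply: IH => //.
    by apply: leq_ltn_trans h1 _; rewrite -eB -/m; move: lt S0; rewrite -/m; lia.
  apply: same_trans S _.
  apply: same_trans (same_sub _ (same_run p_split _)) => //.
  by split=> // x; rewrite /= !inE !negb_or => /and3P[/negbTE-> /negbTE-> _].
have mr : 0 < m%:R :> R by rewrite ltr0n.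
rewrite ler_pdivlMr //.
apply: le_trans (ler_sum _ (fun i _ => main i)).
rewrite big_split /= sumr_const card_ord mulrDl mulr_natr lerD2l -mulr_sumr -mulrA.
have [->|bn0] := eqVneq b 0; first by rewrite !mul0r.
rewrite ler_wpM2l // -ler_pdivlMr //.
apply: sel_pot_step => // i; first exact: sel_pot_ge0.
by have [_ _ /(_ bn0)] := sel_step i b1 b29 lt inv.
Qed.

(** The initial potential is [1 - 4 * n / (8 * n)], one half. *)
Lemma p_selectP (t a b : R) E K tt s : 0 <= b ->
  ireg s 4 = 1%N -> ireg s 29 = 0%N -> (0 < ireg s 3 <= ireg s 1)%N ->
  (b != 0 -> let w := mkseq (rarr s 4) (ireg s 1) in
    (count (fun u => t < u)%R w < ireg s 3 <= count (fun u => t <= u)%R w)%N) ->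
  (forall s', same sel_frame s s' ->
     a + b * (rreg s' 3 == t)%:R <= halts_with E tt K s') ->
  a + b / 2 <= halts_with E (65 * (8 * ireg s 1) + 11 + tt) (p_select :: K) s.
Proof.
move=> b0 e1 e0 zn target post.
have -> : (65 * (8 * ireg s 1) + 11 + tt =
  (65 * (8 * ireg s 1) + 1 + tt).+4.+4.+2)%N by lia.
rewrite /p_select.
do 5 (rewrite halts_seq halts_prim //).
set s1 := step _ _.
have E22 : ireg s1 22 = ireg s 1 by rewrite /= e0 addn0.
have E23 : ireg s1 23 = ireg s 3 by rewrite /= e0 addn0.
have E24 : ireg s1 24 = (8 * ireg s 1)%N by rewrite /=; lia.
have n0 : (0 < ireg s 1)%N by case/andP: zn; apply: leq_trans.
have S1 : same sel_frame s s1.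
  split=> // x; rewrite /= !inE !negb_or => /and5P[_ _ /negbTE-> /negbTE-> /andP[/negbTE-> _]] //.
apply: le_trans (@select_loop t a b E K tt s b0 e1 e0 post (8 * ireg s 1) s1 E24 S1 _).
  rewrite lerD2l ler_wpM2l // /sel_pot E24 E22 muln_eq0 /= gtn_eqF //.
  have nr : (ireg s 1)%:R != 0 :> R by rewrite pnatr_eq0 -lt0n.
  rewrite natrM (_ : 1 - _ = 2^-1); first by rewrite le_max lexx orbT.
  by field; rewrite nr.
by rewrite /sel_inv E22 E23.
Qed.

End Random.

(** * Admissibility in terms of squared distances *)

Section Admissible.
Variables (R : realType) (k n d : nat) (X : 'I_n -> 'rV[R]_d).
Variables (alpha omega : R) (z : nat).
Implicit Type g : 'I_n -> option 'I_k.

Lemma scaled_norm_lt (u v : 'rV[R]_d) : 0 < alpha ->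
  (alpha * l2norm u < l2norm v) = (alpha * alpha * sqn u < sqn v).
Proof.
move=> a0; rewrite -!l2norm_sqr -expr2 -exprMn ltr_sqr ?nnegrE ?l2norm_ge0 //.
by rewrite mulr_ge0 ?l2norm_ge0 // ltW.
Qed.

Lemma balanced_inhabited g : (0 < n)%N -> (0 < k)%N -> 0 < omega -> balanced omega g ->
  forall j, exists x, x \in cluster g j.
Proof.
move=> n0 k0 w0 bal j; apply/set0Pn; rewrite -card_gt0 -(ltr_nat R).
by apply: lt_le_trans (bal j); rewrite divr_gt0 ?mulr_gt0 ?ltr0n.
Qed.

Lemma outliersN g x : x \notin outliers g -> exists2 j, x \in cluster g j & g x = Some j.
Proof.
by rewrite inE; case e: (g x) => [j|] // _; exists j => //; rewrite inE e.
Qed.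

(** As [alpha > 1], center proximity already implies that [g] is induced by its means; only the
    count of outliers remains. For the outliers the quantifier over inliers collapses to the maximum
    [M]. *)
Lemma admissibleP g (M : R) : 1 < alpha -> 0 < omega -> (0 < n)%N -> (0 < k)%N ->
  let D x j := sqn (X x - cluster_mean X g j) in
  (forall x j, x \in cluster g j -> D x j <= M) ->
  M = 0 \/ (exists x j, x \in cluster g j /\ M = D x j) ->
  admissible X alpha omega z g <->
  [/\ #|outliers g| = z, balanced omega g
    & forall x j, g x != Some j ->
      alpha * alpha * (if g x is Some c then D x c else M) < D x j].
Proof.
move=> a1 w0 n0 k0 D DM Mx; have a0 : 0 < alpha by apply: lt_trans a1.
split=> [[[oz _ _] [p1 p2] bal]|[oz bal H]].
  split=> // x j; case gx: (g x) => [c|] nej.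
    rewrite -scaled_norm_lt //; apply: p1; last by rewrite inE gx.
    by apply: contraNneq nej => ->.
  have xZ : x \in outliers g by rewrite inE gx.
  case: Mx => [->|[y [c [yc ->]]]]; last by rewrite -scaled_norm_lt //; apply: p2.
  (* For [M = 0] only positivity of the distance is left, and proximity to any point of the nonempty
     cluster [j] gives it. *)
  rewrite mulr0; have [y yj] := balanced_inhabited n0 k0 w0 bal j.
  rewrite /D -l2norm_sqr exprn_gt0 //; apply: le_lt_trans (p2 j j y x yj xZ).
  by rewrite mulr_ge0 ?l2norm_ge0 // ltW.
have p1 (i j : 'I_k) x : i != j -> x \in cluster g i ->
    alpha * l2norm (X x - cluster_mean X g i) < l2norm (X x - cluster_mean X g j).
  move=> ij; rewrite inE => /eqP gx; rewrite scaled_norm_lt //.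
  by have := H x j; rewrite gx; apply; apply: contraNneq ij => -[->].
have p2 (i j : 'I_k) x y : x \in cluster g i -> y \in outliers g ->
    alpha * l2norm (X x - cluster_mean X g i) < l2norm (X y - cluster_mean X g j).
  move=> xi; rewrite inE => /eqP gy; rewrite scaled_norm_lt //.
  have := H y j; rewrite gy => /(_ isT); apply: le_lt_trans.
  by rewrite ler_wpM2l ?DM // mulr_ge0 // ltW.
have weak u v : alpha * l2norm u < l2norm v -> l2norm u <= l2norm v :> R.
  by move=> /ltW; apply: le_trans; rewrite ler_peMl ?l2norm_ge0 // ltW.
have cd (i : 'I_k) x : x \in cluster g i -> center_dist (cluster_mean X g) (X x) =
    (l2norm (X x - cluster_mean X g i))%:E.
  move=> xi; apply/le_anti/andP; split; first exact: bigmin_le.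
  apply: le_bigmin => [|j _]; first exact: leey.
  rewrite lee_fin; have [<-//|ij] := eqVneq i j.
  exact/weak/p1.
split=> //; split=> // [x y xN yZ|j x xj]; last by rewrite (cd j).
have [i xi _] := outliersN xN; rewrite (cd i) //.
apply: le_bigmin => [|j _]; first exact: leey.
by rewrite lee_fin; apply/weak/p2.
Qed.

(** There are finitely many labellings; finite functions provide the finite type over which to
    minimize. *)
Lemma optimal_exists g : admissible X alpha omega z g ->
  exists f, optimal X alpha omega z (f : 'I_n -> option 'I_k).
Proof.
move=> adg; pose P (h : {ffun 'I_n -> option 'I_k}) := `[< admissible X alpha omega z h >].
have gE : g = [ffun x => g x] by apply: funext => x; rewrite ffunE.
have Pg : P [ffun x => g x] by apply/asboolP; rewrite -gE.
case: (arg_minP (fun h : {ffun 'I_n -> option 'I_k} => kmeans_cost X h) Pg) => f /asboolP adf fmin.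
exists f; split=> // h adh.
have hE : h = [ffun x => h x] by apply: funext => x; rewrite ffunE.
by rewrite hE; apply: fmin; apply/asboolP; rewrite -hE.
Qed.

Lemma sum_cluster (V : nmodType) g (F : 'I_n -> 'I_k -> V) :
  \sum_(j < k) \sum_(x in cluster g j) F x j =
  \sum_(x < n) (if g x is Some c then F x c else 0).
Proof.
under eq_bigr => j _ do rewrite big_mkcond.
rewrite exchange_big /=; apply: eq_bigr => x _.
case gx: (g x) => [c|].
  rewrite (bigD1 c) //= inE gx eqxx big1 ?addr0 // => j jc.
  by rewrite inE gx; case: eqP => // -[cj]; rewrite cj eqxx in jc.
by rewrite big1 // => j _; rewrite inE gx.
Qed.

End Admissible.

(** * Testing one candidate and keeping the best *)

Definition p_check := p_consts ;; p_bal ;; p_cost ;; p_prox.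
Definition p_part1 := p_means ;; p_dist.
Definition p_part2 := p_label ;; p_means ;; p_dist ;; p_check ;; p_update.

Definition protects (c : cmd) : bool :=
  [&& all [pred x | x \notin imods c] [:: 0; 1; 2; 3; 4; 8; 29]%N,
      all [pred x | x \notin rmods c] [:: 0; 1]%N,
      3%N \notin iamods c & 0%N \notin ramods c].

Section States.
Variables (R : realType) (k n d z m : nat) (X : 'I_n -> 'rV[R]_d).
Variables (alpha omega : R).
Implicit Types s : state R.
Hypotheses (k0 : (0 < k)%N) (n0 : (0 < n)%N) (alpha1 : 1 < alpha) (omega0 : 0 < omega).

Definition regs s := ((ireg s 0, ireg s 1, ireg s 2, ireg s 3),
  (ireg s 4, ireg s 8, ireg s 29), (rreg s 0, rreg s 1)).

Definition Base s : Prop :=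
  [/\ regs s = ((k, n, d, z), (1, m, 0)%N, (alpha, omega)),
      forall (i : 'I_n) (l : 'I_d), rarr s 0 (i * d + l)%N = X i ord0 l
    & forall i, (i < n)%N -> iarr s 3 i = (i * d)%N].

Lemma Base_same c s s' : protects c -> same c s s' -> Base s -> Base s'.
Proof.
move=> /and4P[/allP pi /allP pr pia pra] S [e1 e2 e3].
split; last by move=> i; rewrite (sameIA S) //; apply: e3.
  have I x : x \in [:: 0; 1; 2; 3; 4; 8; 29]%N -> ireg s' x = ireg s x.
    by move=> /pi; apply: sameI S.
  have Rr x : x \in [:: 0; 1]%N -> rreg s' x = rreg s x by move=> /pr; apply: sameR S.
  by rewrite -e1 /regs !I // !Rr.
by move=> i l; rewrite (sameRA S).
Qed.

Lemma Base_run c s : protects c -> Base s -> Base (run c s).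
Proof. by move=> pc; apply: Base_same (same_run c s). Qed.

Definition lab s : 'I_n -> option 'I_k := fun x => insub (iarr s 1 x).

Lemma insub_eqSome (v : nat) (j : 'I_k) : (insub v == Some j) = (v == j).
Proof.
case: insubP => [u _ <-|vk]; first by [].
by apply/esym/negbTE; apply: contraNneq vk => ->.
Qed.

Lemma lab_cluster s j x : (x \in cluster (lab s) j) = (iarr s 1 x == j).
Proof. by rewrite inE insub_eqSome. Qed.

Lemma means_lab s (j : 'I_k) (l : 'I_d) : Base s -> ireg s 9 = n ->
  (forall i, (i < n)%N -> iarr s 2 i = i) ->
  rarr (run p_means s) 1 (j * d + l)%N = cluster_mean X (lab s) j ord0 l.
Proof.
case=> [[E0 E1 E2 E3 E4 E8 E29 Ra Ro] EX ER] E9 EB.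
have := @p_meansP R s j l E4; rewrite E0 E2 E9 => -> //.
rewrite mulrC /cluster_mean mxE summxE -sum1_card.
congr (_%:R^-1 * _).
  by rewrite [RHS]big_mkcond; apply: eq_bigr => x _; rewrite lab_cluster; case: eqP.
apply: eq_big => [x|x _]; first by rewrite lab_cluster.
by rewrite EB // ER // EX.
Qed.

Lemma dist_mu s (mu : 'I_k -> 'rV[R]_d) (i : 'I_n) (j : 'I_k) : Base s ->
  (forall (j : 'I_k) (l : 'I_d), rarr s 1 (j * d + l)%N = mu j ord0 l) ->
  rarr (run p_dist s) 2 (i * k + j)%N = sqn (X i - mu j).
Proof.
case=> [[E0 E1 E2 E3 E4 E8 E29 Ra Ro] EX ER] EM.
have := @p_distP R s i j E4; rewrite E0 E1 E2 => -> //.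
by apply: eq_bigr => l _; rewrite !mxE EX EM.
Qed.

Lemma checkP s : Base s ->
  (forall (i : 'I_n) (j : 'I_k), rarr s 2 (i * k + j)%N =
     sqn (X i - cluster_mean X (lab s) j)) ->
  let s' := run p_check s in
  ((ireg s' 21 == ireg s' 3) && (0 < ireg s' 20)%N <->
    admissible X alpha omega z (lab s)) /\
  rreg s' 4 = kmeans_cost X (lab s).
Proof.
move=> B ED /=; rewrite /p_check !runS.
case: (B) => [[E0 E1 E2 E3 E4 E8 E29 Ra Ro] EX ER].
set g := lab s in ED *.
set s1 := run p_consts s; set s2 := run p_bal s1; set s3 := run p_cost s2.
have S1 : same p_consts s s1 by apply: same_run.
have S2 : same p_bal s1 s2 by apply: same_run.
have S3 : same p_cost s2 s3 by apply: same_run.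
have S4 : same p_prox s3 (run p_prox s3) by apply: same_run.
have r9 : rreg s1 9 = omega * n%:R / k%:R.
  by rewrite /s1 /p_consts !runE /= E0 E1 Ro.
have r10 : rreg s1 10 = alpha * alpha by rewrite /s1 /p_consts !runE /= Ra.
have e20 : ireg s1 20 = 1%N by [].
have B1 : Base s1 by apply: Base_run.
have B2 : Base s2 by apply: Base_run.
have B3 : Base s3 by apply: Base_run.
have [F0 F1 F4] : [/\ ireg s1 0 = k, ireg s1 1 = n & ireg s1 4 = 1%N] by case: B1 => [[]].
have [G0 G1 G4] : [/\ ireg s2 0 = k, ireg s2 1 = n & ireg s2 4 = 1%N] by case: B2 => [[]].
have [H0 H1 H4] : [/\ ireg s3 0 = k, ireg s3 1 = n & ireg s3 4 = 1%N] by case: B3 => [[]].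
have bal := @p_balP R s1 F4; lazy zeta in bal.
rewrite -/s2 (sameIA S1) // F0 F1 r9 e20 in bal.
have := @p_costP R s2 G4; lazy zeta; rewrite -/s3 G0 G1.
rewrite (sameIA S2) // (sameIA S1) // (sameRA S2) // (sameRA S1) // => -[c21 c4 c5 c5x].
have prox := @p_proxP R s3 H4; lazy zeta in prox.
rewrite H0 H1 (sameI S3) // (sameIA S3) // (sameIA S2) // (sameIA S1) // in prox.
rewrite (sameRA S3) // (sameRA S2) // (sameRA S1) // (sameR S3) // (sameR S2) // r10 in prox.
have -> : ireg (run p_prox s3) 3 = z.
  by rewrite (sameI S4) // (sameI S3) // (sameI S2) // (sameI S1).
have -> : ireg (run p_prox s3) 21 = #|outliers g|.
  rewrite (sameI S4) // c21 -sum1_card [RHS]big_mkcond /=; apply: eq_bigr => x _.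
  by rewrite inE /g /lab; case: insubP => [u -> //|/negbTE ->].
have gN (x : 'I_n) : g x = None -> (iarr s 1 x < k)%N = false.
  by rewrite /g /lab; case: insubP => // /negbTE.
have gS (x : 'I_n) c : g x = Some c -> iarr s 1 x = c.
  by move=> gx; apply/eqP; rewrite -insub_eqSome -/(lab s x) -/g gx.
split; last first.
  rewrite (sameR S4) // c4 /kmeans_cost.
  rewrite (sum_cluster g (fun x j => l2norm (X x - cluster_mean X g j) ^+ 2)).
  rewrite big_mkcond; apply: eq_bigr => x _.
  case gx: (g x) => [c|]; last by rewrite gN.
  by rewrite (gS _ _ gx) ltn_ord ED l2norm_sqr.
have DM x j : x \in cluster g j -> sqn (X x - cluster_mean X g j) <= rreg s3 5.
  rewrite lab_cluster => /eqP xj; rewrite -ED -xj; apply: c5 => //.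
  by rewrite xj.
have Mx : rreg s3 5 = 0 \/ exists x j, x \in cluster g j /\
    rreg s3 5 = sqn (X x - cluster_mean X g j).
  case: c5x => [->|[i [lin lik ->]]]; [by left|right].
  exists (Ordinal lin), (Ordinal lik); rewrite -ED; split=> //.
  by rewrite lab_cluster.
rewrite (admissibleP z alpha1 omega0 n0 k0 DM Mx).
have cardc (j : 'I_k) : (\sum_(i < n) (iarr s 1 i == j) = #|cluster g j|)%N.
  by rewrite -sum1_card [RHS]big_mkcond; apply: eq_bigr => x _; rewrite lab_cluster; case: eqP.
split=> [/andP[/eqP oz /prox[/bal[_ h1] h2]]|[oz h1 h2]].
  split=> // [j|x j gxj]; first by rewrite -cardc; apply: h1.
  have := h2 x j (ltn_ord _) (ltn_ord _); rewrite ED.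
  case gx: (g x) gxj => [c|] gxj.
    by rewrite (gS _ _ gx) ltn_ord ED; apply; apply: contraNneq gxj => /val_inj ->.
  rewrite gN //; apply; apply: contraFneq (gN _ gx) => <-; exact: ltn_ord.
rewrite oz eqxx; apply/prox; split.
  by apply/bal; split=> // j jk; have := h1 (Ordinal jk); rewrite -cardc.
move=> i j lin ljk nij.
have := h2 (Ordinal lin) (Ordinal ljk); rewrite -ED.
have -> : g (Ordinal lin) != Some (Ordinal ljk).
  by rewrite insub_eqSome eq_sym.
move/(_ isT); case gx: (g (Ordinal lin)) => [c|].
  by have /= -> := gS _ _ gx; rewrite ltn_ord -ED.
by have /= -> := gN _ gx.
Qed.

Definition Best s : Prop := (0 < ireg s 7)%N ->
  admissible X alpha omega z (output k n s) /\
  rreg s 2 = kmeans_cost X (output k n s).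

Definition Opt s : Prop :=
  (0 < ireg s 7)%N /\ optimal X alpha omega z (output k n s).

Lemma Best_same c s s' : same c s s' -> 7%N \notin imods c -> 2%N \notin rmods c ->
  0%N \notin iamods c -> (Best s -> Best s') /\ (Opt s -> Opt s').
Proof.
move=> S h1 h2 h3.
have e7 := sameI S h1; have e2 := sameR S h2.
have eo : output k n s' = output k n s by rewrite /output (sameIA S h3).
by split=> H; rewrite /Best /Opt e7 ?e2 eo; exact: H.
Qed.

(** The check makes bad draws harmless: whatever threshold was selected, only admissible candidates
    are stored. A stored optimum stays, because replacing it takes a strictly smaller cost. An
    optimal candidate that is refused met a stored labelling of no larger cost, which is then
    optimal too. *)
Lemma part2P s : Base s -> Best s -> ireg s 9 = n ->
  (forall i, (i < n)%N -> iarr s 2 i = i) ->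
  let s' := run p_part2 s in
  [/\ Base s', Best s', Opt s -> Opt s'
    & optimal X alpha omega z (lab (run p_label s)) -> Opt s'].
Proof.
move=> B Be E9 EB /=; rewrite /p_part2 4!runS.
set s1 := run p_label s; set s2 := run p_means s1; set s3 := run p_dist s2.
set s4 := run p_check s3.
have S1 : same p_label s s1 by apply: same_run.
have S2 : same p_means s1 s2 by apply: same_run.
have S3 : same p_dist s2 s3 by apply: same_run.
have S4 : same p_check s3 s4 by apply: same_run.
have B1 : Base s1 by apply: Base_run.
have B2 : Base s2 by apply: Base_run.
have B3 : Base s3 by apply: Base_run.
have B4 : Base s4 by apply: Base_run.
have l3 : lab s3 = lab s1.
  by apply: funext => x; rewrite /lab (sameIA S3) // (sameIA S2).
have l4 : lab s4 = lab s1.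
  by rewrite -l3; apply: funext => x; rewrite /lab (sameIA S4).
have [|adm cost] := @checkP s3 B3.
  move=> i j; rewrite l3; apply: dist_mu => // {}j l; apply: means_lab => //.
    by rewrite (sameI S1).
  by move=> {}i lin; rewrite (sameIA S1) // EB.
rewrite -/s4 l3 in adm cost.
clearbody s2 s3 s4.
have [Be4 Op4] : (Best s -> Best s4) /\ (Opt s -> Opt s4).
  have [f1 g1] := Best_same S1 isT isT isT; have [f2 g2] := Best_same S2 isT isT isT.
  have [f3 g3] := Best_same S3 isT isT isT; have [f4 g4] := Best_same S4 isT isT isT.
  split=> [h|h]; first exact: (f4 (f3 (f2 (f1 h)))).
  exact: (g4 (g3 (g2 (g1 h)))).
have {}Be4 := Be4 Be.
have E29 : ireg s4 29 = 0%N by case: B4 => [[]].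
have E1 : ireg s4 1 = n by case: B4 => [[]].
have := @p_updateP R s4 E29; lazy zeta; rewrite E1 andbA.
set s5 := run p_update s4.
have B5 : Base s5 by apply: Base_run.
clearbody s5.
case: ifP => [/andP[/adm ad imp] [u1 u2 u3]|nacc [u1 u2 u3]].
  have oE : output k n s5 = lab s1.
    by rewrite -l4; apply: funext => x; rewrite /output u3.
  split; first exact: B5.
  - by rewrite /Best oE u2 cost.
  - move=> /Op4[f0 [a0 o0]]; have := imp; rewrite f0 /=.
    by rewrite cost (Be4 f0).2 ltNge o0.
  - by rewrite /Opt oE u1.
have oE : output k n s5 = output k n s4 by rewrite /output u3.
split; first exact: B5.
- by rewrite /Best oE u1 u2; exact: Be4.
- by move=> /Op4; rewrite /Opt oE u1; apply.
- move=> [ad op]; have := nacc; rewrite (introT idP (adm.2 ad)) /=.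
  move/negbT; rewrite negb_imply -leNgt cost => /andP[f0 le].
  rewrite /Opt u1 oE; split; first exact: f0.
  have [ad4 c4] := Be4 f0; split=> [|h adh]; first exact: ad4.
  by rewrite -c4; apply: le_trans le _; apply: op.
Qed.

End States.

(** * Good centers recover the clustering *)

Lemma sum_block (V : nmodType) (k m j : nat) (F : nat -> V) : (j < k)%N -> (0 < m)%N ->
  \sum_(p < k * m | (p %/ m == j)%N) F p = \sum_(t < m) F (j * m + t)%N.
Proof.
move=> jk m0.
have lt (t : 'I_m) : (j * m + t < k * m)%N by apply: mulnD_lt.
rewrite (reindex_onto (fun t : 'I_m => Ordinal (lt t))
  (fun p => Ordinal (ltn_pmod (p : 'I_(k * m)) m0))) /=.
  apply: eq_bigl => t; rewrite divnMDl // divn_small // addn0 eqxx /=.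
  by apply/eqP/val_inj; rewrite /= modnMDl modn_small.
by move=> p /eqP pj; apply: val_inj; rewrite /= -pj -divn_eq.
Qed.

Section Good.
Variables (R : realType) (k n d z m : nat) (X : 'I_n -> 'rV[R]_d).
Variables (alpha omega : R).
Implicit Types s : state R.
Hypotheses (k0 : (0 < k)%N) (n0 : (0 < n)%N) (m0 : (0 < m)%N).

Let Base := Base k z m X alpha omega.

Lemma sample_means s (u : seq 'I_n) (j : 'I_k) (l : 'I_d) : Base s ->
  ireg s 9 = (k * m)%N -> (forall p, (p < k * m)%N -> iarr s 1 p = (p %/ m)%N) ->
  size u = (k * m)%N -> mkseq (iarr s 2) (k * m) = [seq val x | x <- u] ->
  rarr (run p_means s) 1 (j * d + l)%N =
  (m%:R^-1 *: \sum_(x <- take m (drop (j * m) u)) X x) ord0 l.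
Proof.
case=> [[E0 E1 E2 E3 E4 E8 E29 Ra Ro] EX ER] E9 EA su EB.
have := @p_meansP R s j l E4; rewrite E0 E2 E9 => -> //.
pose x0 := Ordinal n0.
rewrite mulrC mxE; congr (_^-1 * _).
  congr (_%:R).
  rewrite (eq_bigr (fun p : 'I_(k * m) => if (p %/ m == j)%N then 1 else 0)%N); last first.
    by move=> p _; rewrite EA //; case: eqP.
  by rewrite -big_mkcond (@sum_block nat k m j (fun=> 1%N)) // sum1_card card_ord.
rewrite summxE (eq_bigl (fun p : 'I_(k * m) => p %/ m == j)%N); last first.
  by move=> p; rewrite EA.
rewrite (eq_bigr (fun p : 'I_(k * m) => X (nth x0 u p) ord0 l)); last first.
  move=> p _; have Bp : iarr s 2 p = nth x0 u p.
    by rewrite -(nth_mkseq 0%N (iarr s 2) (ltn_ord p)) EB (nth_map x0) ?su.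
  by rewrite Bp ER // EX.
rewrite (@sum_block _ k m j (fun p => X (nth x0 u p) ord0 l)) //.
rewrite (big_nth x0) big_mkord.
have -> : size (take m (drop (j * m) u)) = m.
  by rewrite size_takel // size_drop su -mulnBl leq_pmull // subn_gt0.
by apply: eq_bigr => t _; rewrite nth_take // nth_drop.
Qed.

Variables (f : 'I_n -> option 'I_k) (mu : 'I_k -> 'rV[R]_d).
Hypothesis z0 : (0 < z)%N.
Hypothesis cardZ : #|outliers f| = z.
Hypothesis near : forall i j x, i != j -> x \in cluster f i ->
  sqn (X x - mu i) < sqn (X x - mu j).
Hypothesis far : forall i j x y, x \in cluster f i -> y \in outliers f ->
  sqn (X x - mu i) < sqn (X y - mu j).

(** The threshold [t] is the least distance of an outlier to the centers [mu]. By [far] it exceeds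
    all inlier distances, so at least [z] values reach it and fewer than [z] exceed it: it is the
    value of rank [z] that selection looks for, even when outliers are tied. *)
Lemma mins_good s : Base s ->
  (forall (i : 'I_n) (j : 'I_k), rarr s 2 (i * k + j)%N = sqn (X i - mu j)) ->
  let s' := run p_mins s in
  (forall x j, f x = Some j -> iarr s' 1 x = j) /\
  exists t, (count (fun v => t < v)%R (mkseq (rarr s' 4) n) < z <=
                 count (fun v => t <= v)%R (mkseq (rarr s' 4) n))%N
    /\ forall x : 'I_n, (rarr s' 3 x < t) = (f x != None).
Proof.
case=> [[E0 E1 E2 E3 E4 E8 E29 Ra Ro] EX ER] ED s'.
have := @p_minsP R s E4 E29; rewrite E0 E1 => /(_ k0); lazy zeta; rewrite -/s'.
case=> _ H.
have Vj (x : 'I_n) : exists2 j : 'I_k, iarr s' 1 x = j & rarr s' 3 x = sqn (X x - mu j).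
  have [Ak VA _ _ _] := H x (ltn_ord x); exists (Ordinal Ak) => //.
  by rewrite VA -ED.
have lab x j : f x = Some j -> iarr s' 1 x = j.
  move=> fx; have [i Ai Vi] := Vj x; rewrite Ai; congr val.
  apply/eqP; apply: contraT => ij.
  have xj : x \in cluster f j by rewrite inE fx.
  have := near (_ : j != i) xj; rewrite eq_sym => /(_ ij).
  by have [_ _ Vm _ _] := H x (ltn_ord x); rewrite -Vi ltNge -ED Vm.
split=> //.
have [y0 y0Z] : exists y, y \in outliers f.
  by apply/set0Pn; rewrite -card_gt0 cardZ.
pose y1 := [arg min_(y < y0 in outliers f) rarr s' 3 y]%O.
exists (rarr s' 3 y1).
have [y1Z y1min] : y1 \in outliers f /\
    forall y, y \in outliers f -> rarr s' 3 y1 <= rarr s' 3 y.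
  by rewrite /y1; case: arg_minP.
have lt (x : 'I_n) : (rarr s' 3 x < rarr s' 3 y1) = (f x != None).
  case fx: (f x) => [j|] /=; last first.
    by apply/negbTE; rewrite -leNgt y1min // inE fx.
  have [j' Aj Vx] := Vj x; have [j1 _ Vy] := Vj y1.
  have jj : j' = j by apply: val_inj; rewrite /= -Aj (lab _ _ fx).
  by rewrite Vx Vy jj far // inE fx.
have cnt (P : pred R) : (count P (mkseq (rarr s' 4) n) =
    #|[set x : 'I_n | P (rarr s' 3 x)]|)%N.
  rewrite -sum1_count big_map -sum1_card.
  rewrite -{1}[n]subn0 -/(index_iota 0 n) big_mkord; apply: eq_bigl => x.
  by rewrite inE; have [_ _ _ -> _] := H x (ltn_ord x).
split=> //; rewrite !cnt -cardZ; apply/andP; split.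
  apply: proper_card; apply/properP; split.
    by apply/subsetP => x; rewrite !inE => /lt_gtF; rewrite lt => /negbFE.
  by exists y1 => //; rewrite inE ltxx.
apply: subset_leq_card; apply/subsetP => x xZ; rewrite inE leNgt lt.
by move: xZ; rewrite inE => ->.
Qed.

Lemma label_good s : Base s -> (forall x j, f x = Some j -> iarr s 1 x = j) ->
  (forall x : 'I_n, (rarr s 3 x < rreg s 3) = (f x != None)) ->
  lab k (run p_label s) = f.
Proof.
case=> [[E0 E1 E2 E3 E4 E8 E29 Ra Ro] EX ER] HA HV.
apply: funext => x; rewrite /lab.
have := @p_labelP R s x; rewrite E0 E1 => -> //; rewrite HV.
case fx: (f x) => [j|] /=; last by rewrite insubF ?ltnn.
by rewrite (HA x j fx); apply/eqP; rewrite insub_eqSome.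
Qed.

End Good.

(** * Sampling, the body of a trial, and step counts *)

Definition sample_body : prog :=
  Seq (Draw 27 1) (Seq (IStore 2 12 27) (IAdd 12 12 reg1)).
Definition p_sample : prog :=
  Seq (compile p_labels) (Seq (ISet 12 0) (While (ILt 12 9) sample_body)).

Definition sample_frame :=
  p_labels ;; Prim (ISet 12 0) ;; Prim (ISet 27 0) ;; Prim (IStore 2 12 27).

Definition p_body : prog :=
  Seq p_sample (Seq (compile p_part1) (Seq (compile p_mins)
    (Seq p_select (compile p_part2)))).

Section Times.
Variable rho : nat -> nat.
Hypotheses (p0 : (0 < rho 0)%N) (p1 : (0 < rho 1)%N) (p2 : (0 < rho 2)%N).

Lemma btime_labels : (0 < rho 8)%N -> (btime rho p_labels <= 30 * (rho 0 * rho 8))%N.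
Proof.
clear p1 p2; move=> p8; have h1 : (rho 0 <= rho 0 * rho 8)%N by rewrite leq_pmulr.
have h2 : (0 < rho 0 * rho 8)%N by rewrite muln_gt0 p0.
by rewrite /btime /=; lia.
Qed.

Lemma btime_means : (0 < rho 9)%N ->
  (btime rho p_means <= 100 * (rho 0 * rho 2 * rho 9))%N.
Proof.
clear p1; move=> p9; have h0 : (0 < rho 0 * rho 2)%N by rewrite muln_gt0 p0.
have h1 : (rho 0 * rho 2 <= rho 0 * rho 2 * rho 9)%N by rewrite leq_pmulr.
have h2 : (rho 0 <= rho 0 * rho 2)%N by rewrite leq_pmulr.
by rewrite /btime /=; lia.
Qed.

Lemma btime_dist : (btime rho p_dist <= 100 * (rho 0 * rho 2 * rho 1))%N.
Proof.
have h0 : (rho 1 <= rho 1 * rho 0)%N by rewrite leq_pmulr.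
have h1 : (rho 1 * rho 0 <= rho 1 * rho 0 * rho 2)%N by rewrite leq_pmulr.
by rewrite /btime /=; lia.
Qed.

Lemma btime_mins : (btime rho p_mins <= 100 * (rho 0 * rho 1))%N.
Proof.
clear p2.
have h0 : (rho 1 <= rho 1 * rho 0)%N by rewrite leq_pmulr.
by rewrite /btime /=; lia.
Qed.

Lemma btime_check : (btime rho p_check <= 300 * (rho 0 * rho 1))%N.
Proof.
clear p2.
have h0 : (rho 1 <= rho 1 * rho 0)%N by rewrite leq_pmulr.
have h1 : (rho 0 <= rho 1 * rho 0)%N by rewrite leq_pmull.
by rewrite /btime /=; lia.
Qed.

Lemma btime_part2 : (0 < rho 9)%N ->
  (btime rho p_part2 <= 100 * (rho 0 * rho 2 * rho 9) +
     700 * (rho 0 * rho 2 * rho 1))%N.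
Proof.
move=> p9.
have h0 : (0 < rho 0 * rho 1)%N by rewrite muln_gt0 p0.
have h1 : (rho 1 <= rho 0 * rho 1)%N by rewrite leq_pmull.
have h2 : (rho 0 * rho 1 <= rho 0 * rho 1 * rho 2)%N by rewrite leq_pmulr.
have tl : (btime rho p_label <= 20 * rho 1)%N by rewrite /btime /=; lia.
have tu : (btime rho p_update <= 80 * rho 1)%N by rewrite /btime /=; lia.
have := btime_means p9; have := btime_dist; have := btime_check.
rewrite /p_part2 -[btime _ (p_label ;; _)]/((btime rho p_label + (btime rho p_means +
  (btime rho p_dist + (btime rho p_check + btime rho p_update).+1).+1).+1).+1)%N.
lia.
Qed.

Lemma btime_part1 : (0 < rho 9)%N ->
  (btime rho p_part1 <= 100 * (rho 0 * rho 2 * rho 9) +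
     101 * (rho 0 * rho 2 * rho 1))%N.
Proof.
move=> p9; have h0 : (0 < rho 0 * rho 2 * rho 1)%N by rewrite !muln_gt0 p0 p2.
have := btime_means p9; have := btime_dist.
rewrite /p_part1 -[btime _ (_ ;; _)]/((btime rho p_means + btime rho p_dist).+1)%N.
lia.
Qed.

End Times.

Section Sample.
Variables (R : realType) (n : nat).
Implicit Type s : state R.
Hypothesis n0 : (0 < n)%N.

(** Induction on the number [r] of draws to come, generalized over the prefix [u] already stored. *)
Lemma sample_loop (G : seq 'I_n -> R) (a b : R) E K tt s0 N :
  ireg s0 4 = 1%N -> ireg s0 1 = n -> ireg s0 9 = N ->
  (forall s' u, same (Prim (ISet 12 0) ;; Prim (ISet 27 0) ;; Prim (IStore 2 12 27)) s0 s' ->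
     size u = N -> mkseq (iarr s' 2) N = [seq val x | x <- u] ->
     a + b * G u <= halts_with E tt K s') ->
  forall r u s, (size u + r)%N = N -> ireg s 12 = size u ->
    same (Prim (ISet 12 0) ;; Prim (ISet 27 0) ;; Prim (IStore 2 12 27)) s0 s ->
    mkseq (iarr s 2) (size u) = [seq val x | x <- u] ->
  a + b * Ex r (fun v => G (u ++ v)) <=
  halts_with E (6 * r + 1 + tt) (While (ILt 12 9) sample_body :: K) s.
Proof.
move=> e4 e1 e9 post; elim=> [|r IH] u s su e12 S eu.
  rewrite addn0 in su; rewrite muln0 add0n add1n halts_while /eval_test.
  rewrite e12 (sameI S) // e9 su ltnn /= cats0; apply: post => //.
  by rewrite -eu su.
have -> : (6 * r.+1 + 1 + tt = (6 * r + 1 + tt).+4.+2)%N by lia.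
rewrite halts_while /eval_test e12 (sameI S) // e9 (_ : (size u < N)%N); last by lia.
rewrite halts_seq halts_draw (sameI S) // e1 ler_pdivlMr ?ltr0n //.
rewrite mulrDl mulr_natr -{1}(card_ord n) -sumr_const -mulrA [Ex _.+1 _]/= divfK ?pnatr_eq0 -?lt0n //.
rewrite mulr_sumr -big_split /=; apply: ler_sum => x _.
set s1 := set_ireg _ 12 _.
have -> : Ex r (fun v => G (u ++ x :: v)) = Ex r (fun v => G (rcons u x ++ v)).
  by apply: eq_Ex => v _; rewrite cat_rcons.
apply: IH.
- by rewrite size_rcons; lia.
- by rewrite /= e12 (sameI S) // e4 size_rcons addn1.
- apply: same_trans S _.
  split=> //= y; rewrite !inE ?negb_or; first by move=> /andP[/negbTE-> /negbTE->].
  by move=> /negbTE->.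
- rewrite size_rcons mkseqS map_rcons /= e12 eqxx; congr rcons.
  rewrite -eu; apply/eq_in_map => i; rewrite mem_iota add0n => iu /=.
  by rewrite ltn_eqF.
Qed.

Lemma p_sampleP (G : seq 'I_n -> R) (a b : R) E K tt s :
  ireg s 4 = 1%N -> ireg s 1 = n -> (0 < ireg s 0)%N -> (0 < ireg s 8)%N ->
  let N := (ireg s 0 * ireg s 8)%N in
  (forall s' u, same sample_frame s s' -> ireg s' 9 = N ->
     (forall p, (p < N)%N -> iarr s' 1 p = (p %/ ireg s 8)%N) ->
     size u = N -> mkseq (iarr s' 2) N = [seq val x | x <- u] ->
     a + b * G u <= halts_with E tt K s') ->
  a + b * Ex N G <= halts_with E (40 * N + tt) (p_sample :: K) s.
Proof.
move=> e4 e1 k0 m0 N post; rewrite /p_sample.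
have N0 : (0 < N)%N by rewrite muln_gt0 k0.
apply: le_trans (halts_mono _ _ _ (_ : (30 * N + (6 * N + 1 + tt).+2).+1 <= _)%N);
  last by lia.
rewrite halts_seq.
have ex := @exec_self R [:: 0; 4; 8]%N p_labels E (6 * N + 1 + tt).+2
  (Seq (ISet 12 0) (While (ILt 12 9) sample_body) :: K) s (30 * N)%N isT isT e4.
apply: le_trans (ex (btime_labels k0 m0)).
have [|l9 l1] := @p_labelsP R s; first by [].
have S1 := same_run p_labels s.
rewrite halts_seq halts_prim //; set s1 := run p_labels s in l9 l1 S1 *.
set s2 := step _ s1.
apply: (@sample_loop G a b E K tt s2 N _ _ _ _ N [::] s2) => //.
- by rewrite /= (sameI S1).
- by rewrite /= (sameI S1).
move=> s' u S2 su eu; apply: post => //.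
- apply: same_trans (same_sub _ S1) _ => //.
  apply: same_trans (_ : same sample_frame s1 s2) (same_sub _ S2) => //.
  by split=> // x; rewrite /= !inE !negb_or => /and5P[_ _ _ _ /andP[/negbTE-> _]].
- by rewrite (sameI S2).
- by move=> p pN; rewrite (sameIA S2) //; apply: l1.
Qed.

End Sample.

(** * One trial and its repetition *)

Section Body.
Variables (R : realType) (k n d z m : nat) (X : 'I_n -> 'rV[R]_d).
Variables (alpha omega : R).
Implicit Types s : state R.
Hypotheses (k0 : (0 < k)%N) (n0 : (0 < n)%N) (d0 : (0 < d)%N) (m0 : (0 < m)%N).
Hypotheses (zn : (0 < z <= n)%N) (alpha1 : 1 < alpha) (omega0 : 0 < omega).

Let Base := Base k z m X alpha omega.
Let Best := @Best R k n d z X alpha omega.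
Let Opt := @Opt R k n d z X alpha omega.

Definition near_far (f : 'I_n -> option 'I_k) (mu : 'I_k -> 'rV[R]_d) : Prop :=
  (forall i j x, i != j -> x \in cluster f i -> sqn (X x - mu i) < sqn (X x - mu j)) /\
  (forall i j x y, x \in cluster f i -> y \in outliers f ->
     sqn (X x - mu i) < sqn (X y - mu j)).

(** What every stage of a trial preserves for all outcomes of the draws. Registers 5 and 6 control
    the repetition. *)
Definition keeps s s' : Prop :=
  [/\ Base s', Best s', Opt s -> Opt s', ireg s' 5 = ireg s 5 & ireg s' 6 = ireg s 6].

Lemma keeps_same c s s' : Base s -> Best s -> protects c -> same c s s' ->
  7%N \notin imods c -> 2%N \notin rmods c -> 0%N \notin iamods c ->
  5%N \notin imods c -> 6%N \notin imods c -> keeps s s'.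
Proof.
move=> B Be pc S h1 h2 h3 h4 h5.
have [f1 f2] := @Best_same R k n d z X alpha omega c s s' S h1 h2 h3.
split; [exact: (Base_same pc S B)|exact: f1|exact: f2|exact: (sameI S h4)|exact: (sameI S h5)].
Qed.

Lemma keeps_trans s1 s2 s3 : keeps s1 s2 -> keeps s2 s3 -> keeps s1 s3.
Proof.
move=> [A1 A2 A3 A4 A5] [B1 B2 B3 B4 B5].
split; [exact: B1|exact: B2|by move=> h; exact: (B3 (A3 h))|by rewrite B4|by rewrite B5].
Qed.

Definition tail_time :=
  (100 * (k * d * (k * m)) + 101 * (k * d * n) + 100 * (k * n) +
   (65 * (8 * n) + 11) + 800 * (k * d * n) + 3)%N.

Lemma tailP (a b : R) E K tt s : 0 <= b -> Base s -> Best s -> ireg s 9 = (k * m)%N ->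
  (b != 0 -> exists f mu, [/\ optimal X alpha omega z f, near_far f mu
     & forall (j : 'I_k) (l : 'I_d), rarr (run p_means s) 1 (j * d + l)%N = mu j ord0 l]) ->
  (forall s', keeps s s' -> a + b * (`[< Opt s' >])%:R <= halts_with E tt K s') ->
  a + b / 2 <= halts_with E (tail_time + tt)
    (Seq (compile p_part1) (Seq (compile p_mins) (Seq p_select (compile p_part2))) :: K) s.
Proof.
move=> b0 B Be E9 good post.
have [E0 E1 E2 E4] : [/\ ireg s 0 = k, ireg s 1 = n, ireg s 2 = d & ireg s 4 = 1%N].
  by case: B => [[]].
have -> : (tail_time + tt = ((100 * (k * d * (k * m)) + 101 * (k * d * n)) +
  ((100 * (k * n)) + ((65 * (8 * n) + 11) + (800 * (k * d * n) + tt)).+1).+1).+1)%N.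
  by rewrite /tail_time; lia.
rewrite halts_seq.
have km0 : (0 < k * m)%N by rewrite muln_gt0 k0.
have b1 : (btime (ireg s) p_part1 <= 100 * (k * d * (k * m)) + 101 * (k * d * n))%N.
  by have := @btime_part1 (ireg s); rewrite E0 E1 E2 E9; apply.
apply: le_trans (@exec_self R [:: 0; 1; 2; 4; 9]%N p_part1 E _ _ s _ isT isT E4 b1).
have S1 := same_run p_part1 s.
have E2d : forall mu : 'I_k -> 'rV[R]_d,
    (forall (j : 'I_k) (l : 'I_d), rarr (run p_means s) 1 (j * d + l)%N = mu j ord0 l) ->
    forall (i : 'I_n) (j : 'I_k), rarr (run p_part1 s) 2 (i * k + j)%N = sqn (X i - mu j).
  move=> mu EM i j; rewrite /p_part1 runS; apply: dist_mu => //.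
  exact: (Base_run (c := p_means) isT B).
have K1 : keeps s (run p_part1 s) by apply: keeps_same S1 _ _ _ _ _.
move: (run p_part1 s) S1 E2d K1 => s1 S1 E2d K1.
have [B1 Be1 _ _ _] := K1.
have [F0 F1 F4 F29] : [/\ ireg s1 0 = k, ireg s1 1 = n, ireg s1 4 = 1%N & ireg s1 29 = 0%N].
  by case: B1 => [[]].
rewrite halts_seq.
have b2 : (btime (ireg s1) p_mins <= 100 * (k * n))%N.
  by have := @btime_mins (ireg s1); rewrite F0 F1; apply.
apply: le_trans (@exec_self R [:: 0; 1; 4; 29]%N p_mins E _ _ s1 _ isT isT F4 b2).
have S2 := same_run p_mins s1.
have [G9 GB] : ireg (run p_mins s1) 9 = n /\
    forall i, (i < n)%N -> iarr (run p_mins s1) 2 i = i.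
  have := @p_minsP R s1 F4 F29; rewrite F0 F1 => /(_ k0) [-> H]; split=> // i lin.
  by have [] := H i lin.
(* Selection needs some [t] even for [b = 0], where nothing is claimed about it; 0 is taken then. *)
have tgt : exists t, b != 0 -> [/\
    (count (fun v => t < v)%R (mkseq (rarr (run p_mins s1) 4) n) < z <=
     count (fun v => t <= v)%R (mkseq (rarr (run p_mins s1) 4) n))%N &
    forall s', same sel_frame (run p_mins s1) s' -> Base s' -> rreg s' 3 = t ->
      optimal X alpha omega z (lab k (run p_label s'))].
  have [bz|bn0] := eqVneq b 0; first by exists 0.
  have [f [mu [opt [nr fr] EM]]] := good bn0.
  have cz : #|outliers f| = z by case: opt => [[[]]].
  have [z0 _] := andP zn.
  have [HA [t [ct Vt]]] := @mins_good R k n d z m X alpha omega k0 f mu z0 cz nr fr s1 B1 (E2d mu EM).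
  exists t => _; split; first exact: ct.
  move=> s' S' B' t3.
  rewrite (@label_good R k n d z m X alpha omega f s') //.
    by move=> x j fx; rewrite (sameIA S') // (HA x j fx).
  by move=> x; rewrite t3 (sameRA S') // Vt.
have {tgt} [t tgt] := tgt.
have K2 : keeps s (run p_mins s1) by apply: keeps_trans K1 _; apply: keeps_same S2 _ _ _ _ _.
move: (run p_mins s1) S2 G9 GB K2 tgt => s2 S2 G9 GB K2 tgt.
have [B2 Be2 _ _ _] := K2.
have [H1 H3 H4 H29] : [/\ ireg s2 1 = n, ireg s2 3 = z, ireg s2 4 = 1%N & ireg s2 29 = 0%N].
  by case: B2 => [[]].
rewrite halts_seq.
have sel := @p_selectP R t a b E (compile p_part2 :: K)
  (800 * (k * d * n) + tt)%N s2 b0 H4 H29.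
rewrite H1 H3 in sel; apply: sel; [exact: zn|by move=> /tgt[]|].
move=> s3 S3.
have K3 : keeps s s3 by apply: keeps_trans K2 _; apply: keeps_same S3 _ _ _ _ _.
have [B3 Be3 _ _ _] := K3.
have [I0 I1 I2 I4] : [/\ ireg s3 0 = k, ireg s3 1 = n, ireg s3 2 = d & ireg s3 4 = 1%N].
  by case: B3 => [[]].
have I9 : ireg s3 9 = n by rewrite (sameI S3).
have IB i : (i < n)%N -> iarr s3 2 i = i by move=> lin; rewrite (sameIA S3) // GB.
have b3 : (btime (ireg s3) p_part2 <= 800 * (k * d * n))%N.
  have := @btime_part2 (ireg s3); rewrite I0 I1 I2 I9 => /(_ k0 n0 d0 n0); lia.
apply: le_trans (@exec_self R [:: 0; 1; 2; 4; 9]%N p_part2 E _ _ s3 _ isT isT I4 b3).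
have [P1 P2 P3 P4] := part2P k0 n0 alpha1 omega0 B3 Be3 I9 IB.
have S4 := same_run p_part2 s3.
apply: le_trans (post _ _); last first.
  apply: keeps_trans K3 _; split; [exact: P1|exact: P2|exact: P3| |].
    by rewrite (sameI S4).
  by rewrite (sameI S4).
have [->|bn0] := eqVneq b 0; first by rewrite !mul0r.
rewrite lerD2l ler_wpM2l // ler_nat.
case: eqP => // t3; rewrite lt0b; apply/asboolP/P4.
by have [_ H] := tgt bn0; apply: H.
Qed.

Definition body_time := (40 * (k * m) + tail_time + 1)%N.

(** The factor [p ^+ k] is the probability bound for [k] independent good blocks; the factor 1/2 is
    the one of selection. *)
Lemma bodyP (p a b : R) E K tt s : 0 <= b -> Base s -> Best s -> 0 <= p ->
  (b != 0 -> exists f (e : 'I_k -> R), [/\ optimal X alpha omega z f,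
     forall mu, (forall j, l2norm (mu j - cluster_mean X f j) <= e j) -> near_far f mu
     & forall j, p <= Ex m (fun v =>
         (l2norm (m%:R^-1 *: \sum_(x <- v) X x - cluster_mean X f j) <= e j)%R%:R)]) ->
  (forall s', keeps s s' -> a + b * (`[< Opt s' >])%:R <= halts_with E tt K s') ->
  a + b * (p ^+ k / 2) <= halts_with E (body_time + tt) (p_body :: K) s.
Proof.
move=> b0 B Be p0 good post.
have [E0 E1 E4 E8] : [/\ ireg s 0 = k, ireg s 1 = n, ireg s 4 = 1%N & ireg s 8 = m].
  by case: B => [[]].
have -> : (body_time + tt = (40 * (k * m) + (tail_time + tt)).+1)%N.
  by rewrite /body_time; lia.
rewrite halts_seq.
(* A boolean test per block, so that the cases [b = 0] and [b != 0] share one statement; without an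
   optimal clustering at hand any test will do. *)
have [gb [gP gx]] : exists gb : nat -> seq 'I_n -> bool,
   (b != 0 -> forall j, (j < k)%N -> p <= Ex m (fun v => (gb j v)%:R)) /\
   (b != 0 -> forall u, blocks m k gb u -> exists f (e : 'I_k -> R),
      [/\ optimal X alpha omega z f,
     forall mu, (forall j, l2norm (mu j - cluster_mean X f j) <= e j) -> near_far f mu
     & forall j : 'I_k, l2norm (m%:R^-1 *: \sum_(x <- take m (drop (j * m) u)) X x
          - cluster_mean X f j) <= e j]).
  have [bz|bn0] := eqVneq b 0; first by exists (fun _ _ => true).
  have [f [e [opt cl pe]]] := good bn0.
  exists (fun j v => if insub j is Some j' then
    l2norm (m%:R^-1 *: \sum_(x <- v) X x - cluster_mean X f j') <= e j' else true).
  split=> [_ j jk|_ u /blocksP bl]; first by rewrite insubT.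
  exists f, e; split=> // j; have := bl j (ltn_ord j).
  by rewrite valK.
apply: le_trans (_ : a + b * Ex (k * m) (fun u => (blocks m k gb u)%:R / 2) <= _).
  have [->|bn0] := eqVneq b 0; first by rewrite !mul0r.
  rewrite lerD2l ler_wpM2l //.
  rewrite (@eq_Ex _ _ _ _ (fun u => 2^-1 * (blocks m k gb u)%:R)) => [|u _]; last by rewrite mulrC.
  by rewrite ExZ mulrC ler_wpM2l ?invr_ge0 // Ex_blocks //; apply: gP.
have := @p_sampleP R n n0 (fun u => (blocks m k gb u)%:R / 2) a b E
  (Seq (compile p_part1) (Seq (compile p_mins) (Seq p_select (compile p_part2))) :: K)
  (tail_time + tt) s E4 E1.
rewrite E0 E8 => /(_ k0 m0); lazy zeta; apply.
move=> s1 u S1 e9 eA su eu; rewrite mulrA.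
have K1 : keeps s s1 by apply: keeps_same S1 _ _ _ _ _.
have [B1 Be1 _ _ _] := K1.
(* For fixed samples [u] the coefficient becomes [b] times the indicator that [u] is good; bad
   samples fall under the case of pure termination. *)
apply: tailP => //; first by rewrite mulr_ge0.
  rewrite mulf_eq0 negb_or pnatr_eq0 eqb0 negbK => /andP[bn0 bl].
  have [f [e [opt cl ce]]] := gx bn0 u bl.
  exists f, (fun j : 'I_k => m%:R^-1 *: \sum_(x <- take m (drop (j * m) u)) X x).
  split=> //; first exact: cl.
  move=> j l; exact: (sample_means n0 m0 j l B1 e9 eA su eu).
move=> s' K'; apply: le_trans (post _ (keeps_trans K1 K')).
rewrite lerD2l; case: (blocks _ _ _ _); first by rewrite mulr1.
by rewrite mulr0 mul0r mulr_ge0.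
Qed.

(* The repetitions: register 5 holds their number, register 6 counts them. *)
Definition p_loop : prog := While (ILt 6 5) (Seq p_body (IAdd 6 6 reg1)).

(** The bound for the remaining rounds is affine in the indicator of [Opt], with new coefficients.
    Hence the body is assumed to work for all [a] and [b]. *)
Lemma loopP (p : R) E K tt a b (T : nat) : 0 <= b -> 0 <= p <= 1 ->
  (b != 0 -> forall a b s K' t', 0 <= b -> Base s -> Best s ->
    (forall s', keeps s s' -> a + b * (`[< Opt s' >])%:R <= halts_with E t' K' s') ->
    a + b * p <= halts_with E (body_time + t') (p_body :: K') s) ->
  (forall s', Base s' -> Best s' -> a + b * (`[< Opt s' >])%:R <= halts_with E tt K s') ->
  forall r s, Base s -> Best s -> (ireg s 6 + r)%N = T -> ireg s 5 = T ->
  a + b * (if `[< Opt s >] then 1 else 1 - (1 - p) ^+ r) <=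
  halts_with E (r * (body_time + 3) + 1 + tt) (p_loop :: K) s.
Proof.
move=> b0 /andP[p0 p1] body post; elim=> [|r IH] s B Be e6 e5.
  rewrite mul0n add0n add1n halts_while /eval_test e5 -e6 addn0 ltnn.
  apply: le_trans (post _ B Be); rewrite lerD2l ler_wpM2l //.
  by case: asboolP => _; rewrite // expr0 subrr.
have -> : (r.+1 * (body_time + 3) + 1 + tt =
   (body_time + (r * (body_time + 3) + 1 + tt).+1).+2)%N by rewrite mulSn; lia.
rewrite halts_while /eval_test e5 -e6 (_ : (ireg s 6 < ireg s 6 + r.+1)%N); last by lia.
rewrite halts_seq.
have next s' : keeps s s' -> a + b * (if `[< Opt s' >] then 1 else 1 - (1 - p) ^+ r)
   <= halts_with E (r * (body_time + 3) + 1 + tt).+1 (IAdd 6 6 reg1 :: p_loop :: K) s'.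
  move=> [B' Be' _ f5 f6]; rewrite halts_prim //; set s2 := step _ s'.
  have S2 : same (Prim (IAdd 6 6 reg1)) s' s2 := same_run (Prim (IAdd 6 6 reg1)) s'.
  have B2 : Base s2 by exact: (Base_same (c := Prim (IAdd 6 6 reg1)) isT S2 B').
  have [h1 _] := @Best_same R k n d z X alpha omega _ _ _ S2 isT isT isT.
  apply: le_trans (IH s2 B2 (h1 Be') _ _).
  - by rewrite lerD2l ler_wpM2l.
  - have E4 : ireg s' 4 = 1%N by case: B' => [[]].
    by rewrite /s2 /= E4 f6 -e6; lia.
  - by rewrite (sameI S2) // f5.
have q0 : 0 <= 1 - p by rewrite subr_ge0.
(* Once the optimum is stored only termination matters, so the body is run with coefficient 0 and
   constant [a + b]. *)
case: asboolP => [op|nop].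
  have := @bodyP 0 (a + b) 0 E (IAdd 6 6 reg1 :: p_loop :: K) (r * (body_time + 3) + 1 + tt).+1 s.
  rewrite eqxx mul0r addr0 mulr1; apply=> // s' Ks; rewrite mul0r addr0.
  apply: le_trans (next s' Ks); case: Ks => _ _ /(_ op) o' _ _.
  by rewrite asboolT // mulr1.
have [bz|bn0] := eqVneq b 0.
  have := @bodyP 0 a 0 E (IAdd 6 6 reg1 :: p_loop :: K) (r * (body_time + 3) + 1 + tt).+1 s.
  rewrite eqxx bz !mul0r addr0; apply=> // s' Ks; rewrite mul0r addr0.
  by apply: le_trans (next s' Ks); rewrite bz mul0r addr0.
have -> : a + b * (1 - (1 - p) ^+ r.+1) =
    (a + b * (1 - (1 - p) ^+ r)) + (b * (1 - p) ^+ r) * p by rewrite exprS; ring.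
apply: body => //; first by rewrite mulr_ge0 // exprn_ge0.
move=> s' Ks; apply: le_trans (next s' Ks).
by case: asboolP => _; rewrite ?mulr1 ?mulr0 ?addr0 //; lra.
Qed.

End Body.

(** * Initialization and the complete program *)

Definition p_double_row := CFor 11 0 (CFor 12 9 (Prim (IAdd 5 5 5))).
(** Turns the 1 in register 5 into the number of repetitions, [2 ^ (k * (k * c))], using additions
    only; nested loops supply the exponent. *)
Definition p_double := CFor 10 0 p_double_row.
Definition p_init := p_row ;; p_double.

Definition p_main (m c : nat) : prog :=
  Seq (ISet 4 1) (Seq (ISet 8 m) (Seq (ISet 5 1) (Seq (ISet 9 c)
    (Seq (compile p_init) p_loop)))).

Section Init.
Variable R : realType.
Implicit Type s : state R.

Lemma double_base s : ireg (run (CFor 12 9 (Prim (IAdd 5 5 5))) s) 5 =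
  (2 ^ ireg s 9 * ireg s 5)%N.
Proof.
apply: (@for_ind _ (fun p s' => ireg s' 5 = 2 ^ p * ireg s 5)%N).
  by rewrite expn0 mul1n.
by move=> p s' _ _ _ e; rewrite runP /= e expnS; lia.
Qed.

Lemma double_row s : ireg (run p_double_row s) 5 =
  (2 ^ (ireg s 0 * ireg s 9) * ireg s 5)%N.
Proof.
apply: (@for_ind _ (fun p s' => ireg s' 5 = 2 ^ (p * ireg s 9) * ireg s 5)%N).
  by rewrite mul0n expn0 mul1n.
move=> p s' _ _ S e; rewrite set_iregE [5%N == _]/= double_base e (sameI S) //.
by rewrite mulSn expnD mulnA.
Qed.

Lemma double s : ireg (run p_double s) 5 =
  (2 ^ (ireg s 0 * (ireg s 0 * ireg s 9)) * ireg s 5)%N.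
Proof.
apply: (@for_ind _ (fun p s' => ireg s' 5 = 2 ^ (p * (ireg s 0 * ireg s 9)) * ireg s 5)%N).
  by rewrite mul0n expn0 mul1n.
move=> p s' _ _ S e; rewrite set_iregE [5%N == _]/= double_row e !(sameI S) //.
by rewrite mulSn expnD mulnA.
Qed.

Lemma btime_init rho : (0 < rho 0)%N -> (0 < rho 1)%N -> (0 < rho 9)%N ->
  (btime rho p_init <= 20 * rho 1 + 30 * (rho 0 * rho 0 * rho 9))%N.
Proof.
move=> p0 p1 p9; have h0 : (0 < rho 0 * rho 0)%N by rewrite muln_gt0 p0.
have h1 : (rho 0 * rho 0 <= rho 0 * rho 0 * rho 9)%N by rewrite leq_pmulr.
have h2 : (rho 0 <= rho 0 * rho 0)%N by rewrite leq_pmulr.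
by rewrite /btime /=; lia.
Qed.

End Init.

Section Main.
Variables (R : realType) (k n d z m c : nat) (X : 'I_n -> 'rV[R]_d).
Variables (alpha omega : R).
Implicit Types s : state R.
Hypotheses (k0 : (0 < k)%N) (n0 : (0 < n)%N) (d0 : (0 < d)%N) (m0 : (0 < m)%N).
Hypothesis c0 : (0 < c)%N.
Hypotheses (zn : (0 < z <= n)%N) (alpha1 : 1 < alpha) (omega0 : 0 < omega).

Let Base := Base k z m X alpha omega.
Let Best := @Best R k n d z X alpha omega.
Let Opt := @Opt R k n d z X alpha omega.
Let T := (2 ^ (k * (k * c)))%N.

Lemma input_rarr (i : 'I_n) (l : 'I_d) :
  rarr (input alpha omega k z X) 0 (i * d + l)%N = X i ord0 l.
Proof.
rewrite /= (bigD1 i) //= (bigD1 l) //= big1 ?addr0 => [|l' /andP[/eqP e ne]].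
  rewrite big1 ?addr0 // => i' ne; rewrite big1 // => l' /eqP e.
  have [e1 _] := mulnD_inj (ltn_ord l') (ltn_ord l) e.
  by rewrite (val_inj e1) eqxx in ne.
have [_ e1] := mulnD_inj (ltn_ord l') (ltn_ord l) e.
by rewrite (val_inj e1) eqxx in ne.
Qed.

Definition main_time :=
  ((20 * n + 30 * (k * k * c)) + (T * (body_time k n d m + 3) + 1) + 9)%N.

(** With [T] repetitions, all polynomial factors in [k], [m] and [c] are absorbed by a second factor
    [T], because [k * k * m <= k * k * c <= T]; hence the exponent is doubled. *)
Lemma main_time_le :
  (m <= c)%N -> (main_time <= 2000 * (2 ^ (2 * (k * (k * c))) * n * d))%N.
Proof.
clear alpha1 omega0 zn => mc.
have U0 : (0 < n * d)%N by rewrite muln_gt0 n0.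
have kT : (k * k * c <= T)%N by rewrite -mulnA ltnW // ltn_expl.
have km : (k * k * m <= k * k * c)%N by rewrite leq_mul2l mc orbT.
have T0 : (0 < T)%N by rewrite expn_gt0.
have bt : (body_time k n d m + 3 <= 1700 * (k * k * m * (n * d)))%N.
  have h1 : (k * m * (k * d) <= k * m * (k * d) * n)%N by rewrite leq_pmulr.
  have h2 : (k * m <= k * m * (k * d))%N by rewrite leq_pmulr // muln_gt0 k0.
  have h3 : (k * d * n <= k * d * n * (k * m))%N by rewrite leq_pmulr // muln_gt0 k0.
  have h4 : (k * n <= k * n * d)%N by rewrite leq_pmulr.
  have h5 : (n <= n * k)%N by rewrite leq_pmulr.
  rewrite /body_time /tail_time; lia.
have -> : (2 ^ (2 * (k * (k * c))) = T * T)%N by rewrite mul2n -addnn expnD.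
have b2 : (T * (body_time k n d m + 3) <= 1700 * (T * T * (n * d)))%N.
  apply: leq_trans (leq_mul (leqnn T) bt) _.
  have h : (k * k * m * (n * d) <= T * (n * d))%N.
    by rewrite leq_mul2r (leq_trans km kT) orbT.
  by apply: leq_trans (leq_mul (leqnn T) (leq_mul (leqnn 1700) h)) _; lia.
have b3 : (k * k * c <= T * T * (n * d))%N.
  apply: leq_trans kT _; rewrite -mulnA leq_pmulr // muln_gt0 T0 //.
have b4 : (n <= T * T * (n * d))%N.
  have h : (n <= n * d)%N by rewrite leq_pmulr.
  by apply: leq_trans h _; rewrite leq_pmull // muln_gt0 T0.
have b5 : (0 < T * T * (n * d))%N by rewrite !muln_gt0 T0 n0.
rewrite /main_time -(mulnA (T * T)%N); lia.
Qed.

Lemma mainP (p : R) E a b : 0 <= b -> 0 <= p <= 1 ->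
  (b != 0 -> exists f (e : 'I_k -> R), [/\ optimal X alpha omega z f,
     forall mu, (forall j, l2norm (mu j - cluster_mean X f j) <= e j) -> near_far X f mu
     & forall j, p <= Ex m (fun v =>
         (l2norm (m%:R^-1 *: \sum_(x <- v) X x - cluster_mean X f j) <= e j)%R%:R)]) ->
  (forall s', Base s' -> Best s' -> a + b * (`[< Opt s' >])%:R <= (`[< E s' >])%:R) ->
  a + b * (1 - (1 - p ^+ k / 2) ^+ T) <=
  success_probability (p_main m c) main_time E (input alpha omega k z X).
Proof.
move=> b0 /andP[p0 p1] good post; rewrite /success_probability.
set s0 := input _ _ _ _ _.
have -> : main_time = ((20 * n + 30 * (k * k * c)) +
   (T * (body_time k n d m + 3) + 1 + 0)).+4.+4.+1.
  by rewrite /main_time; lia.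
rewrite /p_main; do 4 (rewrite halts_seq halts_prim //); rewrite halts_seq.
set s1 := step _ _.
have b1 : (btime (ireg s1) p_init <= 20 * n + 30 * (k * k * c))%N.
  exact: (@btime_init (ireg s1)).
apply: le_trans (@exec_self R [:: 0; 1; 2; 4; 9]%N p_init E _ _ s1 _ isT isT _ b1); last by [].
have S1 := same_run p_init s1.
have e5 : ireg (run p_init s1) 5 = T.
  rewrite /p_init runS double.
  have Sr := same_run p_row s1.
  by rewrite !(sameI Sr) // muln1.
have B2 : Base (run p_init s1).
  split.
  - rewrite /regs (sameI S1 (x := 0)) // (sameI S1 (x := 1)) // (sameI S1 (x := 2)) //.
    rewrite (sameI S1 (x := 3)) // (sameI S1 (x := 4)) // (sameI S1 (x := 8)) //.
    by rewrite (sameI S1 (x := 29)) // (sameR S1 (x := 0)) // (sameR S1 (x := 1)).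
  - by move=> i l; rewrite (sameRA S1) //; apply: input_rarr.
  - move=> i lin; rewrite /p_init runS.
    have Sd := same_run p_double (run p_row s1).
    by rewrite (sameIA Sd) //; apply: (p_rowP (s := s1)).
have E7 : ireg (run p_init s1) 7 = 0%N by rewrite (sameI S1).
have Be2 : Best (run p_init s1) by move=> h; rewrite E7 in h.
have q0 : 0 <= p ^+ k / 2 by rewrite divr_ge0 ?exprn_ge0.
have q1 : p ^+ k / 2 <= 1.
  by rewrite ler_pdivrMr // mul1r (le_trans (exprn_ile1 _ p0 p1)) // ler1n.
have q01 : 0 <= p ^+ k / 2 <= 1 by rewrite q0.
have E6 : (ireg (run p_init s1) 6 + T)%N = T by rewrite (sameI S1).
apply: le_trans (@loopP R k n d z m X alpha omega k0 n0 d0 m0 zn alpha1 omega0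
   (p ^+ k / 2) E [::] 0 a b T b0 q01 _ _ T _ B2 Be2 E6 e5).
- rewrite lerD2l ler_wpM2l //; case: asboolP => // _.
  by rewrite gerBl exprn_ge0 // subr_ge0.
- move=> bn0 a' b' s K' t' b'0 B' Be' post'.
  by apply: (@bodyP R k n d z m X alpha omega) => // _; apply: good.
- by move=> s' B' Be'; apply: post.
Qed.

End Main.

(** * Choice of parameters and conclusion *)

Lemma amplify (R : realType) (q : R) (T : nat) : 0 <= q <= 1 -> 1 <= q * T%:R ->
  1 / 2 <= 1 - (1 - q) ^+ T.
Proof.
move=> /andP[q0 q1] qT.
have bern : 1 + q * T%:R <= (1 + q) ^+ T.
  elim: (T) => [|t IH]; first by rewrite expr0 mulr0 addr0.
  rewrite exprS; apply: le_trans (_ : (1 + q) * (1 + q * t%:R) <= _).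
    rewrite -natr1; have : 0 <= q * q * t%:R by rewrite !mulr_ge0.
    lra.
  by rewrite ler_wpM2l // addr_ge0.
(* The product of the bases is [1 - q ^ 2]. As Bernoulli gives [2 <= (1 + q) ^+ T], the failure
   probability is at most 1/2, without exponentials. *)
have h : (1 - q) ^+ T * (1 + q) ^+ T <= 1.
  by rewrite -exprMn exprn_ile1 //; nra.
have y0 : 0 <= (1 - q) ^+ T by rewrite exprn_ge0 // subr_ge0.
nra.
Qed.

(** The left side is the inverse of the success probability of one trial. It is bounded through
    [k * w < 2 ^ (k * w)]; the summand 2 in [m * w + 2] pays for the factors 2. *)
Lemma reps_large (k w m : nat) : (0 < k)%N ->
  (((k * w) ^ m * 2) ^ k * 2 <= 2 ^ (k * (k * (m * w + 2))))%N.
Proof.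
move=> k0; have h1 : ((k * w) ^ m * 2 <= 2 ^ (k * w * m + 1))%N.
  rewrite expnD expn1 leq_mul2r /= expnM; case: (m) => [|m'] //.
  by rewrite leq_exp2r // ltnW // ltn_expl.
apply: leq_trans (_ : (2 ^ (k * w * m + 1)) ^ k * 2 <= _)%N.
  by rewrite leq_mul2r /= leq_exp2r.
rewrite -expnM -[X in (_ * X)%N]expn1 -expnD leq_exp2l //.
have h2 : (k <= k * k)%N by rewrite leq_pmulr.
have h3 : (0 < k * k)%N by rewrite muln_gt0 k0.
by lia.
Qed.

(** For [omega >= 1] the clusters would use up all [n] points and leave none for the outliers. *)
Lemma no_admissible (R : realType) (k n d z : nat) (X : 'I_n -> 'rV[R]_d)
    (alpha omega : R) f : (0 < k)%N -> (0 < n)%N -> (0 < z)%N -> 1 <= omega ->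
  ~ admissible X alpha omega z (f : 'I_n -> option 'I_k).
Proof.
move=> k0 n0 z0 w1 [[cz _ _] _ bal].
have sum : (\sum_(j < k) #|cluster f j| + #|outliers f| = n)%N.
  under eq_bigr do rewrite -sum1_card.
  rewrite (sum_cluster f (fun _ _ => 1%N)) -(sum1_card (mem (outliers f))).
  rewrite [X in (_ + X)%N]big_mkcond -big_split -[RHS]card_ord -sum1_card /=; apply: eq_bigr => x _.
  by rewrite inE; case: (f x).
have k0' : k%:R != 0 :> R by rewrite pnatr_eq0 -lt0n.
have : (n%:R : R) <= (\sum_(j < k) #|cluster f j|)%:R.
  rewrite natr_sum; apply: le_trans (ler_sum _ (fun j _ => bal j)).
  rewrite sumr_const card_ord -(mulr_natr (_ / _)) divfK //.
  by rewrite ler_peMl.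
by rewrite ler_nat; move: sum; rewrite cz; lia.
Qed.

Theorem theorem3 (R : realType) :
  exists (p : {poly R}) (C : R) (q : R), 0 < q /\
  forall alpha omega : R, 1 < alpha < 2 -> 0 < omega ->
  exists A : prog,
  forall (k n d z : nat) (X : 'I_n -> 'rV[R]_d),
    (0 < k)%N -> (0 < d)%N -> injective X -> (1 <= z <= n)%N ->
  exists t : nat,
    [/\ t%:R <= C * 2 `^ p.[k%:R / (omega * (alpha - 1))] * n%:R * d%:R,
        runs_in_time A t (input alpha omega k z X)
      & (exists f : 'I_n -> option 'I_k, admissible X alpha omega z f) ->
        q <= success_probability A t
               (fun s => optimal X alpha omega z (output k n s))
               (input alpha omega k z X)].
Proof.
(* The value is [72 * 2 ^ 5]: five factors of [72 * N0 ^ 4 * w] are rounded up at the cost of a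
   factor 2 each. [B] and [C] are made opaque to keep large numerals out of the computations. *)
have [B [B0 BE]] : exists B : R, 0 <= B /\ B = 2304 by exists 2304; split; [exact: ler0n|].
have [C [C1 CE]] : exists C : R, 1 <= C /\ C = 2000.
  by exists 2000; split; [rewrite ler1n|].
(* The exponent of the running time is [2 * k * k * c], where [k <= P] and [c <= B * P ^ 5 + 2] for
   the argument [P] of the polynomial. *)
exists ((2 * B)%:P * 'X^7 + 4%:P * 'X^2), C, (1 / 2); split; first by lra.
move=> alpha omega alpha12 omega0; have /andP[alpha1 alpha2] := alpha12.
have pE x : ((2 * B)%:P * 'X^7 + 4%:P * 'X^2).[x] = 2 * B * x ^+ 7 + 4 * x ^+ 2 :> R.
  by rewrite !hornerE.
have a0 : 0 < alpha - 1 by rewrite subr_gt0.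
(* For [omega >= 1] nothing is admissible and one idle step suffices. Otherwise the inverses of
   [omega] and [alpha - 1] are at least 1, so each, like [k], is at most [P]. *)
have [omega1|omega1] := leP 1 omega.
  exists (ISet 0 0) => k n d z X k0 d0 _ /andP[z0 zn].
  have n0 : (0 < n)%N by apply: leq_trans zn.
  exists 1%N; split.
  - rewrite pE; set P := k%:R / _.
    have P0 : 0 <= P by rewrite divr_ge0 // mulr_ge0 // ltW.
    have h1 : 1 <= 2 `^ (2 * B * P ^+ 7 + 4 * P ^+ 2) :> R.
      apply: (le_trans (_ : 1 <= (2 : R) `^ 0)); first by rewrite powRr0.
      apply: ler_powR; first by rewrite ler1n.
      by rewrite addr_ge0 // mulr_ge0 ?exprn_ge0 // mulr_ge0.
    have h2 : 1 <= n%:R * d%:R :> R by rewrite -natrM ler1n muln_gt0 n0.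
    rewrite -mulrA; nra.
  - by rewrite /runs_in_time /success_probability halts_prim //= asboolT.
  - by case=> f /(no_admissible k0 n0 z0 omega1).
(* Natural numbers above the inverses, because [m] and [c] become integer literals of the
   program. *)
pose N0 := (Num.trunc (alpha - 1)^-1).+1; pose w := (Num.trunc omega^-1).+1.
have bnd (x : R) : 0 < x -> x < 1 ->
    x^-1 <= (Num.trunc x^-1).+1%:R /\ (Num.trunc x^-1).+1%:R <= 2 * x^-1 :> R.
  move=> x0 x1; have i0 : 0 <= x^-1 by rewrite invr_ge0 ltW.
  have i1 : 1 <= x^-1 by rewrite invf_ge1 // ltW.
  have /andP[h1 h2] := truncn_itv i0; split; first exact: ltW.
  by rewrite -natr1; lra.
have [N1 N2] : (alpha - 1)^-1 <= N0%:R /\ N0%:R <= 2 * (alpha - 1)^-1.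
  by apply: bnd => //; lra.
have [w1 w2] : omega^-1 <= w%:R /\ w%:R <= 2 * omega^-1 by apply: bnd.
pose m := (72 * N0 ^ 4)%N; pose c := (m * w + 2)%N.
have m0 : (0 < m)%N by rewrite muln_gt0 expn_gt0.
have mP : 72 <= m%:R * (alpha - 1) ^+ 4.
  rewrite natrM natrX -mulrA -exprMn ler_peMr // exprn_ege1 //.
  by rewrite -ler_pdivrMr // mul1r.
have c0 : (0 < c)%N by rewrite /c addn2.
have mc : (m <= c)%N by rewrite /c (leq_trans _ (leq_addr _ _)) // leq_pmulr.
exists (p_main m c) => k n d z X k0 d0 _ zn.
have z0 : (0 < z)%N by case/andP: zn.
have n0 : (0 < n)%N by case/andP: zn => ? ; apply: leq_trans.
(* A block is good with at least this probability: a sample hits its cluster with probability at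
   least [omega / k >= 1 / (k * w)], and Chebyshev costs one half. Its inverse is a natural number,
   as [reps_large] requires. *)
pose p0 : R := ((k * w)%:R^-1) ^+ m / 2.
have kw0 : 0 < (k * w)%:R :> R by rewrite ltr0n muln_gt0 k0.
have p00 : 0 <= p0 by rewrite divr_ge0 // exprn_ge0 // invr_ge0 ltW.
have p01 : p0 <= 1.
  rewrite ler_pdivrMr // mul1r (le_trans _ (ler1n _ 2)) // exprn_ile1 ?invr_ge0 ?(ltW kw0) //.
  by rewrite invf_le1 // ler1n muln_gt0 k0.
exists (main_time k n d m c); split.
- rewrite pE; set P := k%:R / _; set y := 2 * B * P ^+ 7 + _.
  have yE : y = 2 * (P * (P * (B * P ^+ 5 + 2))) by rewrite /y; ring.
  clearbody y; apply: le_trans (_ : (2000 * (2 ^ (2 * (k * (k * c))) * n * d))%:R <= _).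
    by rewrite ler_nat; apply: main_time_le.
  rewrite natrM natrM natrM -CE !mulrA.
  apply: ler_wpM2r; first exact: ler0n.
  apply: ler_wpM2r; first exact: ler0n.
  apply: ler_wpM2l; first exact: le_trans C1.
  rewrite natrX -powR_mulrn //; apply: ler_powR; first by rewrite ler1n.
  rewrite !natrM.
  have i0 : 1 <= omega^-1 by rewrite invf_ge1 // ltW.
  have i1 : 1 <= (alpha - 1)^-1 by rewrite invf_ge1 //; lra.
  have kr : 1 <= k%:R :> R by rewrite ler1n.
  have PE : P = k%:R * omega^-1 * (alpha - 1)^-1 by rewrite /P invfM mulrA.
  have j0 : 0 <= omega^-1 by apply: le_trans i0.
  have j1 : 0 <= (alpha - 1)^-1 by apply: le_trans i1.
  have P1 : k%:R <= P by rewrite PE -mulrA ler_peMr // mulr_ege1.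
  have P2 : omega^-1 <= P by rewrite PE (mulrC k%:R) -mulrA ler_peMr // mulr_ege1.
  have P3 : (alpha - 1)^-1 <= P by rewrite PE ler_peMl // mulr_ege1.
  have P0 : 0 <= P by apply: le_trans P1.
  clearbody P; have tP : 0 <= 2 * P by rewrite mulr_ge0.
  have cP : c%:R <= B * P ^+ 5 + 2.
    rewrite natrD lerD2r /m natrM natrM natrX.
    have -> : B * P ^+ 5 = 72 * (2 * P) ^+ 4 * (2 * P) by rewrite BE; ring.
    apply: ler_pM; [by rewrite mulr_ge0 ?exprn_ge0|exact: ler0n| |].
      apply: ler_wpM2l; first exact: ler0n.
      rewrite lerXn2r ?nnegrE ?tP //.
      by apply: le_trans N2 _; rewrite ler_wpM2l.
    by apply: le_trans w2 _; rewrite ler_wpM2l.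
  rewrite yE.
  apply: ler_wpM2l; first exact: ler0n.
  apply: ler_pM; [exact: ler0n|by rewrite mulr_ge0|exact: P1|].
  by apply: ler_pM; [exact: ler0n|exact: ler0n|exact: P1|exact: cP].
(* Termination is the instance [a = 1], [b = 0]. *)
- apply/eqP; rewrite eq_le halts_le1 /=.
  have := @mainP R k n d z m c X alpha omega k0 n0 d0 m0 c0 zn alpha1 omega0 p0 (fun=> True) 1 0.
  rewrite eqxx mul0r addr0; apply=> //; first by rewrite p00.
  by move=> s' _ _; rewrite mul0r addr0 asboolT.
case=> f0 adm0; have [f opt] := optimal_exists adm0.
pose q0 : R := p0 ^+ k / 2.
(* Success is the instance [a = 0], [b = 1]. *)
apply: le_trans (_ : 0 + 1 * (1 - (1 - q0) ^+ (2 ^ (k * (k * c)))) <= _).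
  rewrite [leRHS]add0r [leRHS]mul1r; apply: amplify.
    rewrite /q0 divr_ge0 ?exprn_ge0 //= ler_pdivrMr // mul1r.
    by rewrite (le_trans (exprn_ile1 _ p00 p01)) // ler1n.
  have -> : q0 = ((((k * w) ^ m * 2) ^ k * 2)%N%:R)^-1.
    rewrite /q0 /p0 [in RHS]natrM [in RHS]natrX [in RHS]natrM [in RHS]natrX.
    by rewrite [RHS]invfM -exprVn [in RHS]invfM -exprVn.
  rewrite mulrC ler_pdivlMr ?mul1r ?ler_nat ?reps_large // ltr0n.
  by rewrite !muln_gt0 expn_gt0 muln_gt0 expn_gt0 muln_gt0 k0.
have adm : admissible X alpha omega z f by case: opt.
have [_ prox bal] := adm.
have ne := balanced_inhabited n0 k0 omega0 bal.
have [e [e0 evar sep1 sep2]] := separation alpha12 prox ne mP.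
have main := @mainP R k n d z m c X alpha omega k0 n0 d0 m0 c0 zn alpha1 omega0 p0
  (fun s => optimal X alpha omega z (output k n s)) 0 1.
apply: main => //; first by rewrite p00.
  move=> _; exists f, e; split=> //.
    move=> mu cl; split.
      by move=> i j x; apply: (close_cluster cl sep1).
    by move=> i j x y; apply: (close_outlier cl sep2).
  move=> j; have cj : (0 < #|cluster f j|)%N by rewrite card_gt0; apply/set0Pn.
  apply: le_trans (@Ex_mean_close R n d X (cluster f j) (cluster_mean X f j) cj erefl m (e j) m0 (e0 j) (evar j)).
  rewrite /p0 ler_wpM2r ?invr_ge0 // lerXn2r ?nnegrE ?divr_ge0 ?invr_ge0 ?(ltW kw0) //.
  rewrite ler_pdivlMr ?ltr0n //; apply: le_trans (bal j).
  have wi : w%:R^-1 <= omega.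
    by rewrite -[leRHS]invrK lef_pV2 ?posrE ?invr_gt0 ?ltr0n.
  have -> : (k * w)%:R^-1 * n%:R = w%:R^-1 * (n%:R / k%:R) :> R.
    by rewrite natrM invfM; ring.
  by rewrite -[leRHS]mulrA ler_wpM2r // divr_ge0.
move=> s' _ _; rewrite add0r mul1r ler_nat.
by case: asboolP => // -[_ o]; rewrite asboolT.
Qed.
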